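(* Fix $\eta\in(0,1)$. Let $k\ge1$, let $K\subseteq\mathbb{R}^k$ be a bounded closed set and let $L\ge 0$. There is a constant $C(K,k,L)$ depending only on $K,k,L$ and $\eta$ such that the following holds. Let $f:K\times K\to[-1,1]$ satisfy $$|f(x,y)-f(x',y')|\le L\|x-x'\|+L\|y-y'\|\qquad\text{for all }x,y,x',y'\in K,$$ let $n\ge1$, $\beta_1,\dots,\beta_n\in K$, $p\in(0,1]$, and let $M$ be the $n\times n$ matrix whose $(i,j)$th element is $f(\beta_i,\beta_j)$. Then the USVT estimator $\hat M$ with tuning parameter $\eta$ satisfies $$\operatorname{MSE}(\hat M)\le C(K,k,L)\,\frac{n^{-1/(k+2)}}{\sqrt p}.$$
   Context: $\|\cdot\|$ is the Euclidean norm on $\mathbb{R}^k$. The data matrix has the form $x_{ij}=f(\beta_i,\beta_j)+\varepsilon_{ij}$ with independent mean-zero errors such that $|x_{ij}|\le1$ almost surely; precisely, one of the following models (order $n\times n$) holds. Asymmetric model (with $m=n$): $X$ is a random $n\times n$ matrix with independent entries, $\mathbb{E}(x_{ij})=m_{ij}$ and $|x_{ij}|\le 1$ almost surely; each entry of $X$ is observed with probability $p$ and unobserved with probability $1-p$, independently of everything else. Symmetric model (when $M$ is symmetric): $X$ is symmetric, its entries on and above the diagonal are independent with $\mathbb{E}(x_{ij})=m_{ij}$ and $|x_{ij}|\le1$ almost surely; each entry on and above the diagonal is observed with probability $p$, independently of everything else, and for $i<j$ the entry $(j,i)$ is observed if and only if $(i,j)$ is. $\operatorname{MSE}(\hat M):=\mathbb{E}\big[\frac1{n^2}\sum_{i,j=1}^n(\hat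 m_{ij}-m_{ij})^2\big]$. USVT estimator with tuning parameter $\eta\in(0,1)$: let $y_{ij}=x_{ij}$ if $x_{ij}$ is observed and $y_{ij}=0$ otherwise, $Y=(y_{ij})$, with singular value decomposition $Y=\sum_{i=1}^n s_iu_iv_i^T$. Let $\hat p$ be the proportion of observed entries of $X$ (in the symmetric model: among those on and above the diagonal). Let $S:=\{i: s_i\ge(2+\eta)\sqrt{n\hat p}\}$ and $W:=\frac1{\hat p}\sum_{i\in S}s_iu_iv_i^T$ (if $\hat p=0$, put $W:=0$). Finally $\hat m_{ij}$ is the truncation of $w_{ij}$ to $[-1,1]$ ($\hat m_{ij}=w_{ij}$ if $|w_{ij}|\le1$, $1$ if $w_{ij}>1$, $-1$ if $w_{ij}<-1$). *)

(* Defs.v *)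
From mathcomp Require Import all_boot all_order all_algebra.
From mathcomp Require Import all_classical all_reals all_analysis.

Set Implicit Arguments.
Unset Strict Implicit.
Unset Printing Implicit Defensive.

Import Order.TTheory GRing.Theory Num.Theory numFieldNormedType.Exports.

Local Open Scope classical_set_scope.
Local Open Scope ring_scope.

(* The library norm on 'rV[R]_k is the sup norm, hence this definition; the
   bounded sets and the closed sets are the same for both norms. *)
Definition enorm (R : realType) (k : nat) (x : 'rV[R]_k) : R :=
  Num.sqrt (\sum_(i < k) x 0 i ^+ 2).

Definition mutually_independent (d : measure_display) (T : measurableType d)
    (R : realType) (P : probability T R) (I : finType) (D : {set I})
    (F : I -> set (set T)) : Prop :=
  forall (J : {set I}) (E : I -> set T),
    J \subset D -> (forall i, i \in J -> F i (E i)) ->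
    P (\bigcap_(i in [set` J]) E i) = (\prod_(i in J) P (E i))%E.

Section model.
Context (d : measure_display) (T : measurableType d) (R : realType)
  (P : probability T R) (n : nat).
Implicit Types (M : 'M[R]_n) (p : R) (X : 'I_n -> 'I_n -> {RV P >-> R})
  (O : 'I_n -> 'I_n -> {RV P >-> bool}) (D : {set 'I_n * 'I_n}).

(* O i j w means that the entry (i, j) is observed at the outcome w.  The index
   inl (i, j) stands for the entry X i j, and inr (i, j) for O i j. *)
Definition generated_sigma X O (s : ('I_n * 'I_n) + ('I_n * 'I_n)) :
    set (set T) :=
  match s with
  | inl ij => preimage_set_system setT (X ij.1 ij.2) measurable
  | inr ij => preimage_set_system setT (O ij.1 ij.2) measurable
  end.

Record entry_model D M p X O : Prop := EntryModel {
  entry_mean : forall i j, (i, j) \in D -> ('E_P[X i j] = (M i j)%:E)%E ;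
  entry_bounded : forall i j, (i, j) \in D ->
    {ae P, forall w, `|X i j w| <= 1} ;
  entry_observed : forall i j, (i, j) \in D ->
    P [set w | O i j w] = p%:E ;
  entry_independent :
    mutually_independent P
      [set s | match s with inl ij => ij \in D | inr ij => ij \in D end]%SET
      (generated_sigma X O) }.

Inductive model_kind := Asymmetric | Symmetric.

Definition free_entries (mk : model_kind) : {set 'I_n * 'I_n} :=
  match mk with
  | Asymmetric => [set: 'I_n * 'I_n]%SET
  | Symmetric => [set ij : 'I_n * 'I_n | (ij.1 <= ij.2)%N]%SET
  end.

Definition data_model (mk : model_kind) M p X O : Prop :=
  match mk with
  | Asymmetric => entry_model (free_entries Asymmetric) M p X O
  | Symmetric =>
      [/\ M^T = M,
          forall i j w, X i j w = X j i w,
          forall i j w, O i j w = O j i w &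
          entry_model (free_entries Symmetric) M p X O]
  end.

Definition observed_matrix X O (w : T) : 'M[R]_n :=
  \matrix_(i, j) if O i j w then X i j w else 0.

Definition observed_proportion (mk : model_kind) O (w : T) : R :=
  #|[set ij in free_entries mk | O ij.1 ij.2 w]%SET|%:R
  / #|free_entries mk|%:R.

Definition MSE (Mhat : T -> 'M[R]_n) M : \bar R :=
  ('E_P[(fun w => (n%:R ^+ 2)^-1 *
           \sum_(i < n) \sum_(j < n) (Mhat w i j - M i j) ^+ 2)%R])%E.

End model.

(* The columns of U and V are the left and right singular vectors. *)
Definition is_svd (R : realType) (n : nat) (Y U : 'M[R]_n) (s : 'I_n -> R)
    (V : 'M[R]_n) : Prop :=
  [/\ U^T *m U = 1%:M, V^T *m V = 1%:M, forall i, 0 <= s i &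
      Y = \sum_(i < n) s i *: (col i U *m (col i V)^T)].

Definition usvt_W (R : realType) (n : nat) (eta phat : R) (U : 'M[R]_n)
    (s : 'I_n -> R) (V : 'M[R]_n) : 'M[R]_n :=
  if phat == 0 then 0 else
  phat^-1 *: \sum_(i < n | (2 + eta) * Num.sqrt (n%:R * phat) <= s i)
               s i *: (col i U *m (col i V)^T).

Definition truncate (R : realType) (x : R) : R :=
  if 1 < x then 1 else if x < -1 then -1 else x.

(* A relation and not a function, as the singular value decomposition is not
   unique; usvt_W does not depend on the choice of the decomposition. *)
Definition is_usvt (R : realType) (n : nat) (eta phat : R)
    (Y Mhat : 'M[R]_n) : Prop :=
  exists U s V, is_svd Y U s V /\
    Mhat = map_mx (@truncate R) (usvt_W eta phat U s V).

(* Main.v *)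
Require Import Defs.
From mathcomp Require Import all_boot all_order all_algebra.
From mathcomp Require Import all_classical all_reals all_analysis.
From mathcomp Require Import measurable_realfun.
From mathcomp Require Import ring lra zify.

(* Let N = Y - pM.  The noise matrix satisfies |N| <= (2 + eta/4) sqrt(np) with
   high probability: E tr N^(2q) is a sum over walks of length 2q in which every
   edge is traversed at least twice, and classifying the steps of a walk (new
   vertex, forced return, other) bounds it by 2n (2a^2 + 4aq)^(2q) with
   a = (np)^(1/4).  The trivial bound MSE <= 4 allows to assume (np)^3 >= n, so q
   can be taken of order a, a power of n, and Markov's inequality beats every
   power of n.
   On this event the threshold (2 + eta) sqrt(n phat) exceeds |N| by a fixed
   fraction.  Partitioning K into about n^(k/(k+2)) cubes of side of order
   n^(-1/(k+2)) makes M close to a matrix whose rows depend only on the cube of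
   beta_i, and pairing such a matrix with one of operator norm kappa gives at most
   kappa n sqrt(#cubes).  This controls both the number of singular values kept
   and the part of pM that is lost.
   Finally phat is compared with p by its variance, and all the exceptional
   events are absorbed in one explicit measurable majorant of the error, since
   nothing is known about the measurability of the estimator. *)

Set Implicit Arguments.
Unset Strict Implicit.
Unset Printing Implicit Defensive.

Import Order.TTheory GRing.Theory Num.Theory numFieldNormedType.Exports.

Local Open Scope classical_set_scope.
Local Open Scope ring_scope.

(** * Walks *)

(** The threshold dictates the form of the norm bound. The noise has to stay below (2 + eta)
    sqrt(np) however small eta is, so a bound of the right order is not enough: the constant 2
    itself must come out of the trace. New steps and forced returns contribute a^2 = sqrt(np) each,
    hence 2a^2 per step, and everything else must be of lower order. For q <= a eta / 32 the term
    4aq is at most (eta/8) a^2, so each of the 2q factors wins the fixed ratio (2 + eta/8) / (2 +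
    eta/4). This gain is exponential in q and beats a power of n only if q is itself at least a
    power of n, which is why very sparse observations are left to the trivial bound. The cubes
    balance two errors. With t^(k+2) = n there are about t^k = n / t^2 of them, so sqrt(#cubes / n)
    and the variation of f over a cube are both of order 1/t. The squared Frobenius error of the
    thresholded matrix is then of order n^2 p^(3/2) / t, and division by n^2 p^2 leaves the stated
    rate. *)

Section walks.
Variables (V E : finType) (adj : rel V) (ed : V -> V -> E).
Hypothesis adjC : symmetric adj.
Hypothesis edC : forall x y, ed x y = ed y x.
Hypothesis ed_inj : forall x y x' y', adj x y -> adj x' y' ->
  ed x y = ed x' y' -> (x = x' /\ y = y') \/ (x = y' /\ y = x').

Implicit Types (x y z : V) (h : seq V) (e : E) (F : {set E}).

(* A walk is given by its current vertex x and the list h of its earlier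
   vertices, the latest one first.  The first visit of a vertex creates a tree
   edge; [once] is the set of the tree edges traversed exactly once so far, and
   [mult e] counts the traversals of e. *)
Fixpoint once x h : {set E} :=
  if h is y :: h' then
    if x \in h then once y h' :\ ed y x else ed y x |: once y h'
  else finset.set0.

Fixpoint mult e x h : nat :=
  if h is y :: h' then ((ed y x == e) + mult e y h')%N else 0%N.

Fixpoint tree x h : {set E} :=
  if h is y :: h' then
    if x \in h then tree y h' else ed y x |: tree y h'
  else finset.set0.

Fixpoint walk x h : bool :=
  if h is y :: h' then adj y x && walk y h' else true.

Definition incident x e := [exists y, adj x y && (ed x y == e)].
Definition deg F x := #|[set e in F | incident x e]%SET|.

(* A step from y to x is new, or traverses a tree edge for the second time
   (back), or is of any other kind (other).  A back step is free if y had several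
   edges of [once] to choose from. *)
Definition back_step x y h := (x \in y :: h) && (ed y x \in once y h).
Definition other_step x y h := (x \in y :: h) && (ed y x \notin once y h).
Definition free_step x y h := back_step x y h && (1 < deg (once y h) y)%N.

Fixpoint count_steps (b : V -> V -> seq V -> bool) x h : nat :=
  if h is y :: h' then (b x y h' + count_steps b y h')%N else 0%N.

Lemma incidentP x y z : adj x y -> incident z (ed x y) = (z == x) || (z == y).
Proof.
move=> xy; apply/existsP/orP => [[w /andP[zw /eqP e]]|[]/eqP ->].
- by case: (ed_inj zw xy e) => [[-> _]|[-> _]]; [left|right].
- by exists y; rewrite xy eqxx.
- by exists x; rewrite adjC xy edC eqxx.
Qed.

Lemma mult_visited e x h : walk x h -> (0 < mult e x h)%N ->
  forall z, incident z e -> z \in x :: h.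
Proof.
elim: h x => [|y h ih] x //= /andP[yx wy].
case: eqP => [<- _ z|_].
  by rewrite incidentP// => /orP[]/eqP ->; rewrite !inE eqxx ?orbT.
by rewrite add0n => m z ze; rewrite in_cons (ih y) ?orbT.
Qed.

(** Both ends of a traversed edge have been visited. *)
Lemma new_mult x y h : adj y x -> walk y h -> x \notin y :: h ->
  mult (ed y x) y h = 0%N.
Proof.
move=> yx wy; apply: contraNeq; rewrite -lt0n => m.
by apply: (mult_visited wy m); rewrite incidentP// eqxx orbT.
Qed.

Lemma once_mult x h e : walk x h -> e \in once x h -> mult e x h = 1%N.
Proof.
elim: h x => [|y h ih] x /=; first by rewrite inE.
case/andP=> yx wy; case: ifPn => xh.
  by rewrite !inE eq_sym => /andP[/negPf-> eo]; rewrite (ih y).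
rewrite !inE => /orP[/eqP->|eo]; first by rewrite eqxx new_mult.
rewrite (ih y)//; case: eqP => // eE.
by have := ih y wy eo; rewrite -eE new_mult.
Qed.

Lemma tree_mult x h e : walk x h -> e \in tree x h -> (0 < mult e x h)%N.
Proof.
elim: h x => [|y h ih] x /=; first by rewrite inE.
case/andP=> yx wy; case: ifPn => xh; last first.
  rewrite !inE => /orP[/eqP->|eo]; first by rewrite eqxx.
  by rewrite ltn_addl// ih.
by move=> eo; rewrite ltn_addl// ih.
Qed.

Lemma once_new x y h : adj y x -> walk y h -> x \notin y :: h ->
  ed y x \notin once y h.
Proof. by move=> yx wy xh; apply/negP => /(once_mult wy); rewrite new_mult. Qed.

(** A tree edge enters [once] when it is created and leaves it at its back step. *)
Lemma card_once x h : walk x h ->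
  (#|once x h| + count_steps back_step x h = #|tree x h|)%N.
Proof.
elim: h x => [|y h ih] x /=; first by rewrite !cards0.
case/andP=> yx wy; have {ih} := ih y wy; rewrite /back_step.
case: ifPn => xh /= ih.
  by rewrite -ih; have := cardsD1 (ed y x) (once y h); lia.
have tn : ed y x \notin tree y h.
  by apply/negP => /(tree_mult wy); rewrite new_mult.
by rewrite !cardsU1 once_new// tn; lia.
Qed.

Lemma count_steps_size x h : walk x h ->
  (#|tree x h| + count_steps back_step x h + count_steps other_step x h
     = size h)%N.
Proof.
elim: h x => [|y h ih] x /=; first by rewrite cards0.
case/andP=> yx wy; have {ih} := ih y wy.
rewrite /back_step /other_step; case: ifPn => xh /=.
  by case: (_ \in _) => /=; lia.
have tn : ed y x \notin tree y h.
  by apply/negP => /(tree_mult wy); rewrite new_mult.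
by rewrite cardsU1 tn; lia.
Qed.

Lemma sum_mult x h : (\sum_e mult e x h = size h)%N.
Proof.
elim: h x => [|y h ih] x /=; first by rewrite big1.
rewrite big_split /= ih (bigD1 (ed y x)) //= eqxx big1 => [|e].
  by rewrite addn0 add1n.
by rewrite eq_sym => /negPf ->.
Qed.

Lemma deg_setU1 F x y z : adj x y -> ed x y \notin F ->
  deg (ed x y |: F) z = ((z == x) || (z == y) + deg F z)%N.
Proof.
move=> xy xyF; rewrite /deg.
rewrite (cardsD1 (ed x y)) !inE eqxx /= incidentP//; congr (_ + _)%N.
apply: eq_card => e; rewrite !inE; case: eqP => //= ->.
by rewrite (negPf xyF).
Qed.

Lemma deg_setD1 F x y z : adj x y -> ed x y \in F ->
  deg F z = ((z == x) || (z == y) + deg (F :\ ed x y) z)%N.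
Proof.
by move=> xy xyF; rewrite -deg_setU1// ?finset.setD1K// !inE eqxx.
Qed.

Lemma once_loop x y h z : walk x h -> ed y z \in once x h -> adj y z -> y != z.
Proof.
elim: h x => [|w h ih] x /=; first by rewrite inE.
case/andP=> wx ww; case: ifPn => xh.
  by rewrite !inE => /andP[_]; exact: ih.
rewrite !inE => /orP[/eqP e|]; last exact: ih.
move=> yz; move: xh; rewrite inE negb_or => /andP[xw _].
by case: (ed_inj yz wx e) => -[-> ->] //; rewrite eq_sym.
Qed.

(* The total excess of the degrees in the forest [once], over 2 away from the
   current vertex and over 1 at it, is a potential: new steps do not increase it,
   free steps decrease it and other steps increase it by at most 1. *)
Definition excess F x z := (deg F z - (z != x).+1)%N.

Lemma free_steps_le x h : walk x h ->
  (count_steps free_step x h + \sum_z excess (once x h) x z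
     <= count_steps other_step x h)%N.
Proof.
elim: h x => [|y h ih] x /=.
  move=> _; rewrite big1// => z _; rewrite /excess /deg.
  suff -> : [set e in finset.set0 | incident z e]%SET = finset.set0 by rewrite cards0.
  by apply/setP => e; rewrite !inE.
case/andP=> yx wy; have {ih} ih := ih y wy.
set F := once y h in ih *; set F' := if _ then _ else _.
(* The potential is compared vertex by vertex: a free step is charged to the vertex [y] that it
   leaves, an other step to the vertex [x] that it enters. *)
have H (z : V) : (excess F' x z + (z == y) * free_step x y h <=
    excess F y z + (z == x) * other_step x y h)%N.
  rewrite /excess /F' /free_step /back_step /other_step -/F.
  case: ifPn => xh /=; last first.
    rewrite !muln0 !addn0 deg_setU1//; last exact: once_new.
    have xy : (x == y) = false.
      by apply: contraNF xh => /eqP ->; rewrite inE eqxx.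
    have [->|zx] := eqVneq z x; last by case: (z == y) => /=; lia.
    rewrite xy /=.
    suff -> : deg F x = 0%N by [].
    apply/eqP; rewrite cards_eq0; apply/eqP/setP => e; rewrite !inE.
    apply/negP => /andP[/(once_mult wy) me ie].
    by move: xh; rewrite (mult_visited wy _ ie)// me.
  have [eF|eF] := boolP (ed y x \in F) => /=; last first.
    have -> : F :\ ed y x = F.
      apply/setP => e; rewrite !inE; case: eqP => //= ->.
      by rewrite (negPf eF).
    by rewrite muln0; case: (z == x); case: (z == y) => /=; lia.
  have xy := once_loop wy eF yx.
  rewrite (deg_setD1 z yx eF) (deg_setD1 y yx eF) eqxx /=.
  have [->|zy] := eqVneq z y; first by rewrite xy /=; lia.
  by case: (z == x) => /=; lia.
have := @leq_sum _ (index_enum V) xpredT _ _ (fun z _ => H z).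
rewrite !big_split/= -!big_distrl/=.
have S1 (u : V) : (\sum_z (z == u) = 1)%N.
  by rewrite (bigD1 u)//= eqxx big1 ?addn0// => i /negPf ->.
by rewrite !S1 !mul1n; lia.
Qed.

Lemma once_eq0 x h : walk x h -> (forall e, mult e x h != 1%N) ->
  once x h = finset.set0.
Proof.
move=> wx m1; apply/setP => e; rewrite inE; apply/negP => /(once_mult wx).
by move/eqP; rewrite (negPf (m1 e)).
Qed.

(** * Weighted count of the walks *)

Variables (R : realFieldType) (a : R) (n : nat).
Hypotheses (a1 : 1 <= a) (n0 : (0 < n)%N).
Hypothesis adj_le : forall y, (#|[set x | adj y x]%SET| <= n)%N.

Definition forced_step x y h := back_step x y h && ~~ free_step x y h.

(* A new step has at most n targets and a forced step at most one, so both kinds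
   have total weight a^2.  As there are at most as many free steps as other
   steps, giving both of them the weight 2a pays for the factor 2 per other step
   of the moment bounds. *)
Definition step_weight x y h : R :=
  if x \in y :: h then (if forced_step x y h then a ^+ 2 else 2 * a)
  else a ^+ 2 / n%:R.

Fixpoint walk_weight x h : R :=
  if h is y :: h' then step_weight x y h' * walk_weight y h' else 1.

Lemma count_forced_free x h :
  (count_steps forced_step x h + count_steps free_step x h =
   count_steps back_step x h)%N.
Proof.
elim: h x => [|y h ih] x //=; rewrite -ih /forced_step /free_step.
by case: (back_step x y h); case: (1 < _)%N => /=; lia.
Qed.

Lemma walk_weightE x h : walk x h ->
  walk_weight x h = (a ^+ 2 / n%:R) ^+ #|tree x h|
    * (a ^+ 2) ^+ count_steps forced_step x h
    * (2 * a) ^+ (count_steps other_step x h + count_steps free_step x h).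
Proof.
elim: h x => [|y h ih] x /=; first by rewrite cards0 !expr0 !mulr1.
case/andP=> yx wy; rewrite ih//.
move: (count_steps _ y h) (count_steps _ y h) (count_steps _ y h) => f o g.
rewrite /step_weight /forced_step /free_step /back_step /other_step.
have [xh|xh] := boolP (x \in y :: h); last first.
  have tn : ed y x \notin tree y h.
    by apply/negP => /(tree_mult wy); rewrite new_mult.
  by rewrite /= cardsU1 tn !add0n add1n (exprS (_ / _)) !mulrA.
have [eo|eo] := boolP (ed y x \in once y h) => /=; last first.
  by move: (_ ^+ #|_|) => c; rewrite !add0n add1n addSn (exprS (2 * a)); ring.
move: (_ ^+ #|_|) => c.
case: (1 < _)%N => /=; rewrite !add0n !add1n ?addnS ?(exprS (2 * a)) ?(exprS (a ^+ 2)); ring.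
Qed.

Lemma walk_weight_ge0 x h : 0 <= walk_weight x h.
Proof.
have a0 : 0 <= a by apply: le_trans a1.
elim: h x => [|y h ih] x //=; rewrite mulr_ge0// /step_weight.
by do 2?case: ifP => _; rewrite ?divr_ge0 ?exprn_ge0 ?mulr_ge0.
Qed.

(** An edge traversed once makes the product vanish. Otherwise a tree edge contributes
    [a ^+ 4 / n%:R], shared between its creation and its return, and every remaining traversal at
    most a factor 2. A free return has only the weight [2 * a] instead of [a ^+ 2]; it is paired
    with an other step, whose weight supplies the missing [a], and there are enough of these by
    [free_steps_le]. *)
Lemma prod_moments_le (mu : E -> nat -> R) x h : walk x h ->
  (forall e m, `|mu e m| <= 2 ^+ m) -> (forall e, mu e 1%N = 0) ->
  (forall e m, `|mu e m.+2| <= a ^+ 4 / n%:R * 2 ^+ m) ->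
  `|\prod_e mu e (mult e x h)| <= walk_weight x h.
Proof.
move=> wx mu0 mu1 mu2.
have a0 : 0 <= a by apply: le_trans a1.
have [/existsP[e /eqP m1]|] := boolP [exists e, mult e x h == 1%N].
  by rewrite (bigD1 e)//= m1 mu1 mul0r normr0 walk_weight_ge0.
rewrite negb_exists => /forallP m1.
have o0 := once_eq0 wx m1.
have := card_once wx; rewrite o0 cards0 add0n => back.
have free := free_steps_le wx.
have size := count_steps_size wx.
have ff := count_forced_free x h.
have tm e : e \in tree x h -> (1 < mult e x h)%N.
  by move=> /(tree_mult wx); have := m1 e; case: (mult e x h) => [|[]].
apply: (@le_trans _ _ ((a ^+ 4 / n%:R) ^+ #|tree x h|
    * 2 ^+ count_steps other_step x h)).
  rewrite normr_prod.
  (* As [once] is empty, there are as many back steps as tree edges. Two traversals are set aside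
     for each tree edge, and the number left over is that of the other steps. *)
  have -> : count_steps other_step x h =
      (\sum_e (mult e x h - 2 * (e \in tree x h)))%N.
    have : (\sum_e (mult e x h - 2 * (e \in tree x h)) +
            \sum_e (2 * (e \in tree x h)) = \sum_e mult e x h)%N.
      rewrite -big_split; apply: eq_bigr => e _ /=; rewrite subnK//.
      by case: (boolP (e \in _)) => // /tm; rewrite muln1.
    rewrite sum_mult -big_distrr/= -big_mkcond/= sum1_card; lia.
  rewrite -[X in _ <= X * _]prodr_const [X in _ <= X * _]big_mkcond/= expr_sum -big_split/=.
  apply: ler_prod => e _; rewrite normr_ge0 /=.
  case: (boolP (e \in _)) => /= [/tm|_]; last by rewrite mul1r subn0.
  by case: (mult e x h) => [|[|m]]// _; rewrite muln1 subn2/=.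
rewrite walk_weightE//; rewrite back in ff.
set t := #|tree x h| in ff back *; set g := count_steps forced_step x h in ff *.
set o := count_steps other_step x h in free *.
set f := count_steps free_step x h in ff free *.
rewrite -{}ff.
have {free} /subnK <- : (f <= o)%N by lia.
set c := (o - f)%N.
rewrite (_ : a ^+ 4 / n%:R = a ^+ 2 / n%:R * a ^+ 2); last first.
  by rewrite [RHS]mulrAC -exprD.
have b0 : 0 <= a ^+ 2 by rewrite exprn_ge0.
have -> : (2 * a) ^+ (c + f + f) =
   ((a ^+ 2) ^+ f * 2 ^+ (c + f)) * (2 ^+ f * a ^+ c).
  by rewrite [a ^+ 2]expr2 !exprD !exprMn; ring.
move: (a ^+ 2) b0 => b b0.
rewrite exprMn -[leLHS]mulrA -[leRHS]mulrA ler_wpM2l//.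
  by rewrite exprn_ge0// divr_ge0.
rewrite exprD -[leLHS]mulrA ler_wpM2l ?exprn_ge0//.
rewrite ler_peMr ?mulr_ge0 ?exprn_ge0//.
by rewrite mulr_ege1 ?exprn_ege1// ler1n.
Qed.

(** The history is carried along because the weight of a step depends on all the vertices visited
    before it. *)
Fixpoint walk_sum k (G : V -> seq V -> R) x h : R :=
  if k is k'.+1 then \sum_(y | adj x y) walk_sum k' G y (x :: h) else G x h.

Lemma sum_step_weight y h :
  \sum_(x | adj y x) step_weight x y h <= 2 * a ^+ 2 + 2 * a * (size h).+1%:R.
Proof.
have a0 : 0 <= a by apply: le_trans a1.
have nR : (0 : R) < n%:R by rewrite ltr0n.
apply: (@le_trans _ _ (\sum_(x | adj y x) (a ^+ 2 / n%:R
    + (forced_step x y h)%:R * a ^+ 2 + (x \in y :: h)%:R * (2 * a)))).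
  apply: ler_sum => x _; rewrite /step_weight.
  case: ifPn => xh; last by rewrite -addrA lerDl addr_ge0 ?mulr_ge0 ?ler0n ?exprn_ge0.
  have w0 : 0 <= a ^+ 2 / n%:R by rewrite divr_ge0// ?exprn_ge0.
  case: ifPn => _; rewrite ?mul1r ?mul0r ?addr0.
    by rewrite -addrA addrCA lerDl addr_ge0// ?mulr_ge0 ?ler0n.
  by rewrite lerDr.
rewrite !big_split/= sumr_const -!big_distrl/=.
apply: lerD; first rewrite (_ : 2 * a ^+ 2 = a ^+ 2 + a ^+ 2); first apply: lerD.
- rewrite -[leLHS]mulr_natr [leLHS]mulrAC ler_pdivrMr// ler_wpM2l ?exprn_ge0//.
  by rewrite ler_nat; apply: leq_trans (adj_le y); rewrite cardsE.
- rewrite -[leRHS]mul1r ler_wpM2r ?exprn_ge0//.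
  rewrite -natr_sum lern1 -big_mkcondr/= sum1_card.
  (* Two forced targets would give two distinct edges of [once] at [y], and the steps would be
     free. *)
  rewrite leqNgt; apply/negP => c1.
  have /card_gt1P[x1 [x2 [m1 m2 x12]]] := c1.
  move: m1 m2; rewrite !unfold_in => /andP[yx1 f1] /andP[yx2 f2].
  move: f1 f2; rewrite /forced_step /free_step => /andP[b1].
  rewrite b1 /= => d1 /andP[b2 _]; move/negP: d1; apply.
  apply/card_gt1P; exists (ed y x1), (ed y x2); rewrite !inE !incidentP// eqxx /=.
  move: b1 b2 => /andP[_ ->] /andP[_ ->]; split=> //.
  apply: contra_neq x12 => /(ed_inj yx1 yx2)[[_ //]|[yx2E x1y]].
  by rewrite x1y.
- by ring.
rewrite mulrC ler_wpM2l ?mulr_ge0//.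
rewrite -natr_sum ler_nat -big_mkcondr/= sum1_card.
apply: leq_trans (card_size (y :: h)).
by apply: subset_leq_card; apply/fintype.subsetP => x; rewrite inE => /andP[].
Qed.

Lemma walk_sum_weight N k x h : (size h + k <= N)%N ->
  walk_sum k walk_weight x h <=
    walk_weight x h * (2 * a ^+ 2 + 2 * a * N%:R) ^+ k.
Proof.
have a0 : 0 <= a by apply: le_trans a1.
have B0 : 0 <= 2 * a ^+ 2 + 2 * a * N%:R by rewrite addr_ge0 ?mulr_ge0 ?exprn_ge0.
elim: k x h => [|k ih] x h; first by rewrite expr0 mulr1.
move=> hN /=; apply: (@le_trans _ _ (\sum_(y | adj x y)
    step_weight y x h * (walk_weight x h * (2 * a ^+ 2 + 2 * a * N%:R) ^+ k))).
  by apply: ler_sum => y _; rewrite mulrA; apply: ih => /=; lia.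
rewrite -big_distrl /= [_ ^+ k.+1]exprS [leRHS]mulrCA.
rewrite ler_wpM2r ?mulr_ge0 ?walk_weight_ge0 ?exprn_ge0//.
apply: le_trans (sum_step_weight _ _) _.
by rewrite lerD2l ler_wpM2l ?mulr_ge0// ler_nat; lia.
Qed.

Lemma walk_sum_le k G1 G2 x h : walk x h ->
  (forall y g, walk y g -> G1 y g <= G2 y g) ->
  walk_sum k G1 x h <= walk_sum k G2 x h.
Proof.
move=> wx G12; elim: k x h wx => [|k ih] x h wx /=; first exact: G12.
by apply: ler_sum => y xy; apply: ih; rewrite /= xy.
Qed.

Lemma sum_prod_moments_le (mu : E -> nat -> R) k :
  (forall e m, `|mu e m| <= 2 ^+ m) -> (forall e, mu e 1%N = 0) ->
  (forall e m, `|mu e m.+2| <= a ^+ 4 / n%:R * 2 ^+ m) ->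
  \sum_x walk_sum k (fun x h => `|\prod_e mu e (mult e x h)|) x [::] <=
    #|V|%:R * (2 * a ^+ 2 + 2 * a * k%:R) ^+ k.
Proof.
move=> mu0 mu1 mu2; rewrite mulr_natl -sumr_const; apply: ler_sum => x _.
apply: (@le_trans _ _ (walk_sum k walk_weight x [::])).
  by apply: walk_sum_le => // y g wy; exact: prod_moments_le.
by have := @walk_sum_weight k k x [::] (leqnn k); rewrite /= mul1r.
Qed.

End walks.

(** * Powers of a symmetric kernel *)

(** Lagrange's identity: the double sum of the squares of [f i * g j - f j * g i] is twice the
    defect. *)
Lemma cauchy_schwarz_sum (R : realFieldType) (I : finType) (P : pred I)
    (f g : I -> R) :
  (\sum_(i | P i) f i * g i) ^+ 2 <=
    (\sum_(i | P i) f i ^+ 2) * (\sum_(i | P i) g i ^+ 2).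
Proof.
set F := \sum_(i | P i) f i ^+ 2; set G := \sum_(i | P i) g i ^+ 2.
set S := \sum_(i | P i) f i * g i.
have E : \sum_(i | P i) \sum_(j | P j) (f i * g j - f j * g i) ^+ 2 =
    F * G + G * F - S * S - S * S.
  rewrite !big_distrlr/= -big_split -!sumrB; apply: eq_bigr => i _ /=.
  rewrite -big_split -!sumrB; apply: eq_bigr => j _ /=; ring.
have : 0 <= \sum_(i | P i) \sum_(j | P j) (f i * g j - f j * g i) ^+ 2.
  by apply: sumr_ge0 => i _; apply: sumr_ge0 => j _; exact: sqr_ge0.
by rewrite E; lra.
Qed.

Section kernel_powers.
Variables (R : realFieldType) (V : finType) (adj : rel V) (H : V -> V -> R).
Hypothesis HC : forall x y, H x y = H y x.

Definition kernel_mul (u : V -> R) x := \sum_y H x y * u y.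

Fixpoint kernel_pow k (x y : V) : R :=
  if k is k'.+1 then \sum_z H x z * kernel_pow k' z y else (x == y)%:R.

Fixpoint walk_prod (x : V) (h : seq V) : R :=
  if h is y :: h' then H y x * walk_prod y h' else 1.

(** The expansion of a power of the kernel over walks. The weight [phi] of the last vertex serves to
    select the closed walks of a trace. *)
Lemma walk_sum_kernel_pow (phi : V -> R) k x h :
  (forall x y, ~~ adj x y -> H x y = 0) ->
  walk_sum adj k (fun y g => walk_prod y g * phi y) x h =
  walk_prod x h * \sum_y kernel_pow k x y * phi y.
Proof.
move=> H0; elim: k x h => [|k ih] x h /=.
  rewrite (bigD1 x)//= eqxx mul1r big1 ?addr0// => y.
  by rewrite eq_sym => /negPf ->; rewrite mul0r.
under [in RHS]eq_bigr do rewrite big_distrl/=.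
rewrite [in RHS]exchange_big/= big_distrr [RHS](bigID (adj x))/=.
rewrite [X in _ = _ + X]big1 => [|y xy]; last first.
  by rewrite big1 ?mulr0// => z _; rewrite H0// !mul0r.
rewrite addr0; apply: eq_bigr => y xy; rewrite ih/= big_distrr/= big_distrr/=.
by apply: eq_bigr => z _; ring.
Qed.

Lemma iter_kernel_mul k u x :
  iter k kernel_mul u x = \sum_y kernel_pow k x y * u y.
Proof.
elim: k x => [|k ih] x /=.
  rewrite (bigD1 x)//= eqxx mul1r big1 ?addr0// => y.
  by rewrite eq_sym => /negPf ->; rewrite mul0r.
transitivity (\sum_z H x z * iter k kernel_mul u z) => //.
under [LHS]eq_bigr do rewrite ih big_distrr/=.
rewrite exchange_big; apply: eq_bigr => y _ /=; rewrite big_distrl/=.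
by apply: eq_bigr => z _; rewrite mulrA.
Qed.

Lemma kernel_powD j k x y :
  kernel_pow (j + k) x y = \sum_z kernel_pow j x z * kernel_pow k z y.
Proof.
elim: j x => [|j ih] x /=.
  rewrite (bigD1 x)//= eqxx mul1r big1 ?addr0// => z.
  by rewrite eq_sym => /negPf ->; rewrite mul0r.
under eq_bigr do rewrite ih big_distrr/=.
rewrite exchange_big; apply: eq_bigr => z _ /=; rewrite big_distrl/=.
by apply: eq_bigr => w _; rewrite mulrA.
Qed.

Lemma kernel_powC k x y : kernel_pow k x y = kernel_pow k y x.
Proof.
elim: k x y => [|k ih] x y; first by rewrite /= eq_sym.
rewrite -[in RHS]addn1 kernel_powD; apply: eq_bigr => z _.
rewrite /= (bigD1 x)//= eqxx mulr1 big1 ?addr0 => [|w].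
  by rewrite mulrC ih HC.
by move=> /negPf ->; rewrite mulr0.
Qed.

Lemma kernel_trace_double k :
  \sum_x kernel_pow k.*2 x x = \sum_x \sum_y kernel_pow k x y ^+ 2.
Proof.
apply: eq_bigr => x _; rewrite -addnn kernel_powD.
by apply: eq_bigr => y _; rewrite [kernel_pow k y x]kernel_powC.
Qed.

Lemma kernel_mul_sym u v :
  \sum_x u x * kernel_mul v x = \sum_x kernel_mul u x * v x.
Proof.
rewrite /kernel_mul; under eq_bigr do rewrite big_distrr/=.
rewrite exchange_big; apply: eq_bigr => y _ /=; rewrite big_distrl/=.
by apply: eq_bigr => z _; rewrite HC; ring.
Qed.

(* The squared norms a_k of H^k u are log-convex, so a_1^k <= a_0^(k-1) a_k. *)
Lemma kernel_mul_trace k u : (0 < k)%N ->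
  (\sum_x kernel_mul u x ^+ 2) ^+ k <=
  (\sum_x u x ^+ 2) ^+ k * \sum_x kernel_pow k.*2 x x.
Proof.
move=> k0; pose a j := \sum_x iter j kernel_mul u x ^+ 2.
have a_ge0 j : 0 <= a j by apply: sumr_ge0 => x _; exact: sqr_ge0.
have convex j : a j.+1 ^+ 2 <= a j * a j.+2.
  apply: le_trans (cauchy_schwarz_sum xpredT (iter j kernel_mul u)
    (iter j.+2 kernel_mul u)).
  rewrite (kernel_mul_sym (iter j kernel_mul u) (iter j.+1 kernel_mul u)).
  by under eq_bigr do rewrite -expr2.
have ratio j : a 1%N * a j <= a 0%N * a j.+1.
  elim: j => [|j ih]; first by rewrite mulrC.
  have [a0|] := eqVneq (a j.+1) 0; first by rewrite a0 mulr0 mulr_ge0.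
  rewrite neq_lt ltNge a_ge0/= => a_gt0.
  rewrite -(ler_pM2r a_gt0) -mulrA -expr2.
  apply: (le_trans (ler_wpM2l (a_ge0 _) (convex j))).
  rewrite mulrA [leRHS]mulrAC; exact: ler_wpM2r.
have power j : a 1%N ^+ j * a 0%N <= a 0%N ^+ j * a j.
  elim: j => [|j ih]; first by rewrite !expr0.
  rewrite exprS -mulrA; apply: (le_trans (ler_wpM2l (a_ge0 _) ih)).
  rewrite mulrCA exprSr -mulrA; apply: ler_wpM2l (ratio j).
  by rewrite exprn_ge0.
(* The operator norm of [H^k] is at most its Hilbert-Schmidt norm, whose square is the trace of
   [H^(2k)]. *)
have trace : a k <= a 0%N * \sum_x kernel_pow k.*2 x x.
  rewrite kernel_trace_double mulrC big_distrl/=; apply: ler_sum => x _.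
  rewrite iter_kernel_mul; exact: cauchy_schwarz_sum.
rewrite -/(a 0%N) -/(a 1%N).
have [a00|] := eqVneq (a 0%N) 0.
  have : a 1%N = 0.
    apply/eqP; have := convex 0%N; rewrite a00 mul0r => a10.
    by rewrite -sqrf_eq0 eq_le a10 sqr_ge0.
  move=> ->; rewrite a00 expr0n; case: k k0 {trace} => //= k _.
  by rewrite mul0r.
rewrite neq_lt ltNge a_ge0/= => a_gt0.
rewrite -(ler_pM2r a_gt0); apply: le_trans (power k) _.
rewrite -mulrA ler_wpM2l ?exprn_ge0//.
by rewrite mulrC.
Qed.

End kernel_powers.

(** * Singular value thresholding *)

Section op_bound.
Variables (R : rcfType) (n : nat).
Implicit Types (A B X : 'M[R]_n) (x y : 'cV[R]_n) (k l : R).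

Definition dot x y : R := (x^T *m y) 0 0.
Definition mxdot A B : R := \tr (A *m B^T).

Lemma dotE x y : dot x y = \sum_i x i 0 * y i 0.
Proof. by rewrite /dot mxE; apply: eq_bigr => i _; rewrite mxE. Qed.

Lemma mxdotE A B : mxdot A B = \sum_i \sum_j A i j * B i j.
Proof.
rewrite /mxdot /mxtrace; apply: eq_bigr => i _.
by rewrite mxE; apply: eq_bigr => j _; rewrite mxE.
Qed.

Lemma dot_ge0 x : 0 <= dot x x.
Proof. by rewrite dotE; apply: sumr_ge0 => i _; rewrite -expr2 sqr_ge0. Qed.

Lemma mxdot_ge0 A : 0 <= mxdot A A.
Proof.
rewrite mxdotE; apply: sumr_ge0 => i _; apply: sumr_ge0 => j _.
by rewrite -expr2 sqr_ge0.
Qed.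

(** For [k >= 0] this means that the operator norm of [A] is at most [k]; the squared bilinear form
    avoids square roots. *)
Definition op_bound k A := forall x y,
  (dot x (A *m y)) ^+ 2 <= k ^+ 2 * (dot x x * dot y y).

Lemma op_boundB k l A B : 0 <= k -> 0 <= l ->
  op_bound k A -> op_bound l B -> op_bound (k + l) (A - B).
Proof.
move=> k0 l0 Ak Bl x y; set c := dot x x * dot y y.
have c0 : 0 <= c by rewrite mulr_ge0 ?dot_ge0.
have sq (z m : R) : 0 <= m -> z ^+ 2 <= m ^+ 2 * c -> `|z| <= m * Num.sqrt c.
  move=> m0 zm; rewrite -ler_sqr ?nnegrE ?mulr_ge0 ?sqrtr_ge0//.
  by rewrite exprMn sqr_sqrtr// real_normK ?num_real.
have -> : dot x ((A - B) *m y) = dot x (A *m y) - dot x (B *m y).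
  by rewrite mulmxBl /dot mulmxBr !mxE.
rewrite -[c]sqr_sqrtr// -exprMn -[leLHS]real_normK ?num_real//.
rewrite ler_sqr ?nnegrE ?mulr_ge0 ?addr_ge0 ?sqrtr_ge0//.
apply: le_trans (ler_normB _ _) _; rewrite mulrDl.
by apply: lerD; apply: sq => //; first [exact: Ak | exact: Bl].
Qed.

Lemma op_bound_rot k A (U V : 'M[R]_n) : U *m U^T = 1%:M -> V *m V^T = 1%:M ->
  op_bound k A -> op_bound k (U^T *m A *m V).
Proof.
move=> UU VV Ak x y.
have := Ak (U *m x) (V *m y); rewrite /dot !trmx_mul !mulmxA.
have U1 : U^T *m U = 1%:M by apply: mulmx1C.
have V1 : V^T *m V = 1%:M by apply: mulmx1C.
rewrite -[x^T *m U^T *m U]mulmxA -[y^T *m V^T *m V]mulmxA U1 V1 !mulmx1.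
by [].
Qed.

Lemma mxdot_rot A B (U V : 'M[R]_n) : U *m U^T = 1%:M -> V *m V^T = 1%:M ->
  mxdot (U^T *m A *m V) (U^T *m B *m V) = mxdot A B.
Proof.
move=> UU VV; rewrite /mxdot !trmx_mul trmxK !mulmxA.
rewrite -[_ *m V *m V^T]mulmxA VV mulmx1 -!mulmxA mxtrace_mulC -!mulmxA.
by rewrite UU mulmx1.
Qed.

Lemma op_bound_col k A j : op_bound k A -> \sum_i A i j ^+ 2 <= k ^+ 2.
Proof.
move=> Ak; have := Ak (col j A) (delta_mx j 0).
have -> : A *m delta_mx j 0 = col j A by rewrite colE.
have -> : dot (delta_mx j 0) (delta_mx j 0) = 1.
  rewrite dotE (bigD1 j)//= !mxE !eqxx mulr1 big1 ?addr0// => i ij.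
  by rewrite !mxE (negPf ij) mul0r.
rewrite mulr1 -[\sum_i _ ^+ 2]/(\sum_i A i j ^+ 2).
have -> : dot (col j A) (col j A) = \sum_i A i j ^+ 2.
  by rewrite dotE; apply: eq_bigr => i _; rewrite !mxE expr2.
set a := \sum_i _; have : 0 <= a by apply: sumr_ge0 => i _; rewrite sqr_ge0.
rewrite le_eqVlt => /orP[/eqP <-|a0]; first by rewrite sqr_ge0.
by rewrite expr2 ler_pM2r.
Qed.

Lemma op_bound_entry k A i j : 0 <= k -> op_bound k A -> `|A i j| <= k.
Proof.
move=> k0 /op_bound_col => /(_ j) Aj.
rewrite -ler_sqr ?nnegrE// real_normK ?num_real//; apply: le_trans Aj.
by rewrite (bigD1 i)//= lerDl; apply: sumr_ge0 => l _; exact: sqr_ge0.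
Qed.

Definition diag_fun (d : 'I_n -> R) : 'M[R]_n := \matrix_(i, j) (d i *+ (i == j)).

Lemma op_bound_diag k (d : 'I_n -> R) : (forall i, `|d i| <= k) ->
  op_bound k (diag_fun d).
Proof.
move=> dk x y.
have -> : dot x (diag_fun d *m y) = \sum_i x i 0 * (d i * y i 0).
  rewrite dotE; apply: eq_bigr => i _; rewrite mxE (bigD1 i)//= mxE eqxx.
  rewrite big1 ?addr0// => j; rewrite mxE eq_sym => /negPf ->.
  by rewrite mul0r.
apply: le_trans (cauchy_schwarz_sum _ _ _) _; rewrite mulrCA !dotE.
have -> : \sum_i x i 0 ^+ 2 = \sum_i x i 0 * x i 0.
  by apply: eq_bigr => i _; rewrite expr2.
apply: ler_wpM2l; first by apply: sumr_ge0 => i _; rewrite -expr2 sqr_ge0.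
rewrite big_distrr/=; apply: ler_sum => i _.
rewrite exprMn -expr2 ler_wpM2r ?sqr_ge0//.
have k0 : 0 <= k by apply: le_trans (dk i).
by rewrite -[d i ^+ 2]real_normK ?num_real// ler_sqr ?nnegrE.
Qed.

Definition col_restr (P : pred 'I_n) A : 'M[R]_n := \matrix_(i, j) (A i j *+ P j).

Lemma op_bound_restr k A (P : pred 'I_n) : op_bound k A ->
  op_bound k (col_restr P A).
Proof.
move=> Ak x y.
pose z : 'cV[R]_n := \col_j (y j 0 *+ P j).
have -> : col_restr P A *m y = A *m z.
  apply/matrixP => i j; rewrite !mxE; apply: eq_bigr => l _; rewrite !mxE.
  by rewrite (ord1 j); case: (P l); rewrite ?mulr0 ?mul0r.
apply: (le_trans (Ak x z)); rewrite ler_wpM2l ?sqr_ge0//.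
rewrite ler_wpM2l ?dot_ge0// !dotE; apply: ler_sum => j _; rewrite !mxE.
by case: (P j); rewrite ?mulr0n ?mulr0// -expr2 sqr_ge0.
Qed.

(* On the rows of one block, M is nearly constant in the row index, so X is paired
   there with a matrix of rank one. *)
Lemma mxdot_blocks k rho (C : finType) (c : 'I_n -> C) (g : C -> 'I_n -> R)
    X (M : 'M[R]_n) : 0 <= k -> 0 <= rho ->
  (forall a j, `|g a j| <= 1) ->
  (forall i j, `|M i j - g (c i) j| <= rho) ->
  op_bound k X ->
  mxdot X M <= k * n%:R * Num.sqrt #|C|%:R + rho * n%:R * Num.sqrt (mxdot X X).
Proof.
move=> k0 rho0 g1 Mg Xk.
have -> : mxdot X M = \sum_i \sum_j X i j * g (c i) j +
    \sum_i \sum_j X i j * (M i j - g (c i) j).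
  rewrite mxdotE -big_split; apply: eq_bigr => i _ /=; rewrite -big_split.
  by apply: eq_bigr => j _ /=; ring.
apply: lerD.
- pose F a := \sum_(i | c i == a) \sum_j X i j * g a j.
  have -> : \sum_i \sum_j X i j * g (c i) j = \sum_a 1 * F a.
    rewrite (partition_big c xpredT)//=; apply: eq_bigr => a _; rewrite mul1r.
    by apply: eq_bigr => i /eqP ->.
  (* The indicator of a block has squared norm equal to the size of the block. The sizes add up to
     [n], so Cauchy-Schwarz over the blocks costs only the root of their number. *)
  have F2 a : F a ^+ 2 <= k ^+ 2 * n%:R * \sum_i (c i == a)%:R.
    pose x : 'cV[R]_n := \col_i (c i == a)%:R.
    pose y : 'cV[R]_n := \col_j g a j.
    have -> : F a = dot x (X *m y).
      rewrite dotE /F big_mkcond; apply: eq_bigr => i _; rewrite !mxE.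
      case: eqP => _; rewrite ?mul0r// mul1r; apply: eq_bigr => j _.
      by rewrite mxE.
    apply: (le_trans (Xk x y)); rewrite -mulrA ler_wpM2l ?sqr_ge0// mulrC.
    have -> : dot x x = \sum_i (c i == a)%:R.
      rewrite dotE; apply: eq_bigr => i _; rewrite mxE.
      by case: eqP => _; rewrite ?mulr0 ?mulr1.
    apply: ler_wpM2r; first by apply: sumr_ge0 => i _; rewrite ler0n.
    rewrite dotE -[X in _ <= X%:R]card_ord -sumr_const.
    apply: ler_sum => j _; rewrite mxE -expr2 -[leLHS]real_normK ?num_real//.
    by rewrite expr_le1.
  rewrite -mulrA; set b := k * _.
  have b0 : 0 <= b by rewrite !mulr_ge0 ?sqrtr_ge0.
  apply: le_trans (ler_norm _) _; rewrite -ler_sqr ?nnegrE//.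
  rewrite real_normK ?num_real//; apply: le_trans (cauchy_schwarz_sum _ _ _) _.
  rewrite sumr_const expr1n /b 2!exprMn sqr_sqrtr// mulrA [leLHS]mulrC.
  rewrite -mulr_natl; apply: ler_wpM2r => //.
  apply: (le_trans (ler_sum _ (fun a _ => F2 a))).
  rewrite -big_distrr/= exchange_big/=.
  have -> : \sum_i \sum_a (c i == a)%:R = n%:R :> R.
    rewrite -[in RHS](card_ord n) -sumr_const; apply: eq_bigr => i _.
    rewrite (bigD1 (c i))//= eqxx big1 ?addr0// => a.
    by rewrite eq_sym => /negPf ->.
  by rewrite mulr1 -mulrA -expr2.
- rewrite -mulrA; set b := rho * _.
  apply: (@le_trans _ _ (rho * \sum_i \sum_j `|X i j| * 1)).
    rewrite big_distrr/=; apply: ler_sum => i _; rewrite big_distrr/=.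
    apply: ler_sum => j _; rewrite mulr1 mulrC.
    apply: le_trans (ler_norm _) _; rewrite normrM; exact: ler_wpM2r.
  rewrite ler_wpM2l//.
  rewrite -ler_sqr ?nnegrE ?mulr_ge0 ?sqrtr_ge0//; last first.
    by apply: sumr_ge0 => i _; apply: sumr_ge0 => j _; rewrite mulr1.
  rewrite exprMn sqr_sqrtr ?mxdot_ge0// pair_bigA/=.
  apply: le_trans (cauchy_schwarz_sum _ _ _) _.
  rewrite sumr_const expr1n card_prod card_ord mulrC natrM -expr2.
  rewrite ler_wpM2l ?sqr_ge0// mxdotE pair_bigA/=; apply: ler_sum => -[i j] _ /=.
  by rewrite real_normK ?num_real// expr2.
Qed.

(* With G = p M, N = Y - G and Q the projection on the right singular vectors
   kept, T - G = N Q - G (1 - Q).  Since G (1 - Q) has operator norm at most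
   tau + lam, pairing it with G bounds its Frobenius norm; pairing the partial
   isometry \sum_(S i) u_i v_i^T with G bounds the number of values kept.  The
   proof works in the singular bases, where Y is diagonal. *)
Lemma svd_threshold_bound (Y M U V : 'M[R]_n) (s : 'I_n -> R) (p rho tau lam : R)
    (C : finType) (c : 'I_n -> C) (g : C -> 'I_n -> R) (S : pred 'I_n) :
  U^T *m U = 1%:M -> V^T *m V = 1%:M -> (forall i, 0 <= s i) ->
  Y = \sum_(i < n) s i *: (col i U *m (col i V)^T) ->
  0 <= p -> 0 <= rho -> 0 <= lam -> 0 <= tau ->
  (forall a j, `|g a j| <= 1) ->
  (forall i j, `|M i j| <= 1) ->
  (forall i j, `|M i j - g (c i) j| <= rho) ->
  (forall i, S i = (tau <= s i)) ->
  op_bound lam (Y - p *: M) ->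
  let T := \sum_(i < n | S i) s i *: (col i U *m (col i V)^T) in
  #|S|%:R * (tau - lam) <= p * (n%:R * Num.sqrt #|C|%:R
     + rho * n%:R * Num.sqrt n%:R) /\
  mxdot (T - p *: M) (T - p *: M) <= #|S|%:R * lam ^+ 2 +
     p * ((tau + lam) * n%:R * Num.sqrt #|C|%:R) + rho * p ^+ 2 * n%:R ^+ 2.
Proof.
move=> U1 V1 s0 YE p0 rho0 lam0 tau0 g1 M1 Mg SE Nlam T.
have UU : U *m U^T = 1%:M by apply: mulmx1C.
have VV : V *m V^T = 1%:M by apply: mulmx1C.
have rotE (P : pred 'I_n) :
    U^T *m (\sum_(i < n | P i) s i *: (col i U *m (col i V)^T)) *m V =
    diag_fun (fun i => s i *+ P i).
  rewrite mulmx_sumr mulmx_suml.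
  under eq_bigr => i _.
    rewrite -scalemxAr -scalemxAl !colE trmx_mul !mulmxA U1 mul1mx -!mulmxA V1.
    rewrite mulmx1 trmx_delta mul_delta_mx.
    over.
  apply/matrixP => i j; rewrite summxE mxE [LHS]big_mkcond (bigD1 i)//=.
  rewrite big1 ?addr0 => [|l li].
    case: (P i); rewrite ?mxE ?eqxx/= ?mulr0n ?mul0rn//.
    by rewrite eq_sym; case: eqP => _; rewrite ?mulr1 ?mulr0.
  by case: (P l); rewrite ?mxE// eq_sym (negPf li) /= mulr0.
set G := p *: M in Nlam *.
pose G' := U^T *m G *m V; pose N' := U^T *m (Y - G) *m V.
have N'lam : op_bound lam N' by exact: op_bound_rot.
have YE' : U^T *m Y *m V = diag_fun s.
  by rewrite YE rotE.
have GE' : G' = diag_fun s - N' by rewrite /N' mulmxBr mulmxBl YE' opprB addrC subrK.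
have G'E : G' = U^T *m G *m V by [].
clearbody N' G'.
have back A : U^T *m (U *m A *m V^T) *m V = A.
  by rewrite !mulmxA U1 mul1mx -mulmxA V1 mulmx1.
have opback k A : op_bound k A -> op_bound k (U *m A *m V^T).
  by move=> Ak; rewrite -[U]trmxK; apply: op_bound_rot; rewrite ?trmxK.
have dotback A B : mxdot (U *m A *m V^T) B = mxdot A (U^T *m B *m V).
  by rewrite -(mxdot_rot _ _ UU VV) back.
split.
  pose Q := diag_fun (fun i => (S i)%:R).
  have Q1 : op_bound 1 Q.
    by apply: op_bound_diag => i; rewrite normr_nat lern1 leq_b1.
  have QQ : mxdot Q Q = #|S|%:R.
    rewrite mxdotE -sumr_const [RHS]big_mkcond; apply: eq_bigr => i _.
    rewrite (bigD1 i)//= big1 ?addr0 => [|j]; rewrite !mxE.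
      by rewrite eqxx mulr1n unfold_in; case: (S i); rewrite ?mulr1 ?mulr0.
    by rewrite eq_sym => /negPf ->; rewrite mul0r.
  have := mxdot_blocks ler01 rho0 g1 Mg (opback _ _ Q1).
  rewrite !dotback back QQ mul1r => QM.
  have {QM} : p * mxdot Q (U^T *m M *m V) <=
      p * (n%:R * Num.sqrt #|C|%:R + rho * n%:R * Num.sqrt n%:R).
    apply: ler_wpM2l => //; apply: (le_trans QM).
    rewrite lerD2l ler_wpM2l ?mulr_ge0// ler_wsqrtr// ler_nat.
    by rewrite -[leqRHS]card_ord max_card.
  apply: le_trans.
  have -> : p * mxdot Q (U^T *m M *m V) = mxdot Q G'.
    by rewrite G'E /G -scalemxAr -scalemxAl /mxdot linearZ/= -scalemxAr mxtraceZ.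
  have -> : mxdot Q G' = \sum_(i | S i) G' i i.
    rewrite mxdotE [RHS]big_mkcond; apply: eq_bigr => i _.
    rewrite (bigD1 i)//= big1 ?addr0 => [|j]; rewrite !mxE.
      by rewrite eqxx mulr1n; case: (S i); rewrite ?mul1r ?mul0r.
    by rewrite eq_sym => /negPf ->; rewrite mul0r.
  rewrite mulr_natl -sumr_const.
  apply: (@le_trans _ _ (\sum_(i | S i) (tau - lam))); first exact: lexx.
  apply: ler_sum => i; rewrite SE => ti.
  rewrite GE' !mxE eqxx mulr1n lerB//.
  by apply: le_trans (ler_norm _) _; exact: op_bound_entry.
(* In the singular bases the projection [Q] keeps the columns in [S]: the error is the noise there
   and minus the signal elsewhere, and the two parts are orthogonal. *)
have TE' : U^T *m (T - G) *m V = col_restr S N' - col_restr (predC S) G'.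
  rewrite mulmxBr mulmxBl rotE -G'E.
  apply/matrixP => i j; rewrite GE' !mxE /=.
  have [->|ij] := eqVneq i j; first by case: (S j) => /=; rewrite ?mulr0n ?mulr1n; ring.
  by case: (S i); case: (S j) => /=; rewrite ?mulr0n ?mulr1n; ring.
have -> : mxdot (T - G) (T - G) = \sum_(j | S j) \sum_i N' i j ^+ 2 +
    mxdot (col_restr (predC S) G') (col_restr (predC S) G').
  rewrite -(mxdot_rot _ _ UU VV) TE' !mxdotE exchange_big/=.
  rewrite [X in _ = X + _]big_mkcond [X in _ = _ + X]exchange_big -big_split.
  apply: eq_bigr => j _ /=.
  case: ifPn => Sj; [rewrite [X in _ = _ + X]big1 ?addr0 => [|i _]| rewrite add0r].
  - by apply: eq_bigr => i _; rewrite !mxE /= Sj /= ?mulr0n ?mulr1n subr0 expr2.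
  - by rewrite !mxE /= Sj /= ?mulr0n mul0r.
  - by apply: eq_bigr => i _; rewrite !mxE /= (negPf Sj) /= ?mulr0n ?mulr1n !sub0r mulrNN.
set X := col_restr (predC S) G'.
rewrite -addrA; apply: lerD.
  rewrite mulr_natl -sumr_const.
  by apply: ler_sum => j _; exact: op_bound_col.
have Xop : op_bound (tau + lam) X.
  have -> : X = diag_fun (fun i => s i *+ ~~ S i) - col_restr (predC S) N'.
    apply/matrixP => i j; rewrite mxE GE' !mxE /=.
    have [->|ij] := eqVneq i j; first by case: (S j) => /=; rewrite ?mulr0n ?mulr1n; ring.
    by case: (S i); case: (S j) => /=; rewrite ?mulr0n ?mulr1n; ring.
  apply: op_boundB => //; last exact: op_bound_restr.
  apply: op_bound_diag => i; rewrite SE -ltNge.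
  by case: ltP => si; rewrite ?mulr0n ?mulr1n ?normr0// ger0_norm// ltW.
(* [X] consists of columns of [G'], so its square is its pairing with [G'], which is a pairing with
   [M] to which the block bound applies. *)
have XG : mxdot X X = p * mxdot (U *m X *m V^T) M.
  have -> : mxdot X X = mxdot X G'.
    rewrite !mxdotE; apply: eq_bigr => i _; apply: eq_bigr => j _.
    by rewrite !mxE /=; case: (S j); rewrite /= ?mulr0n ?mul0r.
  by rewrite dotback G'E /G -scalemxAr -scalemxAl /mxdot linearZ/= -scalemxAr mxtraceZ.
(* The block bound contains the norm of [X] again, but with the factor [rho], so the crude bound by
   the norm of [G] is enough there. *)
have XX : Num.sqrt (mxdot X X) <= p * n%:R.
  rewrite -[leRHS]ger0_norm ?mulr_ge0// -sqrtr_sqr ler_wsqrtr//.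
  apply: (@le_trans _ _ (mxdot G' G')).
    rewrite !mxdotE; apply: ler_sum => i _; apply: ler_sum => j _.
    by rewrite !mxE /=; case: (S j); rewrite /= ?mulr0n ?mul0r// -expr2 sqr_ge0.
  rewrite G'E mxdot_rot// mxdotE exprMn [n%:R ^+ 2]expr2 -natrM.
  rewrite -[X in (X * _)%:R]card_ord -[X in (_ * X)%:R]card_ord -card_prod.
  rewrite mulr_natr -sumr_const pair_bigA/=; apply: ler_sum => -[i j] _ /=.
  rewrite !mxE -expr2 exprMn ler_piMr ?sqr_ge0//.
  by rewrite -[leLHS]real_normK ?num_real// expr_le1.
have := mxdot_blocks (addr_ge0 tau0 lam0) rho0 g1 Mg (opback _ _ Xop).
have -> : mxdot (U *m X *m V^T) (U *m X *m V^T) = mxdot X X by rewrite dotback back.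
move=> XM; rewrite XG.
have {XM} XM := le_trans XM (lerD (lexx _) (ler_wpM2l (mulr_ge0 rho0 (ler0n _ _)) XX)).
apply: (le_trans (ler_wpM2l p0 XM)).
by rewrite mulrDr lerD2l le_eqVlt; apply/orP; left; apply/eqP; ring.
Qed.

End op_bound.

(** * Truncation and the error on the good event *)

Lemma truncate_contract (R : realType) (x m : R) : `|m| <= 1 ->
  (truncate x - m) ^+ 2 <= (x - m) ^+ 2.
Proof.
rewrite ler_norml => /andP[m1 m2]; rewrite /truncate.
by case: ltP => x1; [nra|case: ltP => x2; [nra|]].
Qed.

Lemma truncate_norm (R : realType) (x : R) : `|truncate x| <= 1.
Proof.
by rewrite ler_norml /truncate; case: ltP => x1;
  [lra|case: ltP => x2; [lra|apply/andP; split]].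
Qed.

(** A deterministic estimate. The parameter [eps] is the common order of the two balanced errors,
    with constants [c1] for the number of blocks and [c2] for the approximation. *)
Lemma usvt_error (R : realType) (n : nat) (eta p phat c1 c2 eps rho : R)
    (Y M Mhat : 'M[R]_n) (C : finType) (c : 'I_n -> C) (g : C -> 'I_n -> R) :
  0 < eta < 1 -> (0 < n)%N -> 0 < p <= 1 ->
  0 <= c1 -> 0 <= c2 -> 0 <= eps ->
  `|phat - p| <= eta / 6 * p ->
  (forall a j, `|g a j| <= 1) -> (forall i j, `|M i j| <= 1) ->
  (forall i j, `|M i j - g (c i) j| <= rho) -> 0 <= rho -> rho <= c2 * eps ->
  Num.sqrt #|C|%:R <= c1 * (Num.sqrt n%:R * eps) ->
  op_bound ((2 + eta / 4) * Num.sqrt (n%:R * p)) (Y - p *: M) ->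
  is_usvt eta phat Y Mhat ->
  (n%:R ^+ 2)^-1 * \sum_(i < n) \sum_(j < n) (Mhat i j - M i j) ^+ 2 <=
    4 * ((36 / eta + 9) * (c1 + c2)) * (eps / Num.sqrt p)
    + 4 * ((phat - p) ^+ 2 / p ^+ 2).
Proof.
move=> /andP[eta0 eta1] n0 /andP[p0 p1] c10 c20 eps0.
rewrite ler_norml => /andP[ph1 ph2] g1 M1 Mg rho0 rhoc Cc Nlam.
move=> [U [s [V [[U1 V1 s0 YE] ->]]]].
have ph0 : 0 < phat by nra.
set T := \sum_(i < n | (2 + eta) * Num.sqrt (n%:R * phat) <= s i)
           s i *: (col i U *m (col i V)^T).
have nR : (0 : R) < n%:R by rewrite ltr0n.
set rn : R := Num.sqrt n%:R; set rp := Num.sqrt p.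
have rn0 : 0 < rn by rewrite sqrtr_gt0.
have rp0 : 0 < rp by rewrite sqrtr_gt0.
have rnE : n%:R = rn ^+ 2 by rewrite sqr_sqrtr// ltW.
have rpE : p = rp ^+ 2 by rewrite sqr_sqrtr// ltW.
have rp1 : rp <= 1 by rewrite -sqrtr1 ler_wsqrtr.
have thE : Num.sqrt (n%:R * p) = rn * rp by rewrite sqrtrM// ltW.
set rph := Num.sqrt phat.
have rph0 : 0 < rph by rewrite sqrtr_gt0.
have rphE : phat = rph ^+ 2 by rewrite sqr_sqrtr// ltW.
have thhE : Num.sqrt (n%:R * phat) = rn * rph by rewrite sqrtrM// ltW.
(* The relative error [eta / 6] allowed for [phat] lowers the threshold at most to
   [(2 + eta / 2) * (rn * rp)], which leaves a gap of [eta / 4] above the noise. *)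
have low : (2 + eta / 2) * rp <= (2 + eta) * rph.
  rewrite -ler_sqr ?nnegrE ?mulr_ge0 ?(ltW rp0) ?(ltW rph0)//; try lra.
  rewrite !exprMn -rpE -rphE.
  apply: (@le_trans _ _ ((2 + eta) ^+ 2 * ((1 - eta / 6) * p))).
    by rewrite mulrA ler_wpM2r ?(ltW p0)//; nra.
  by rewrite ler_wpM2l ?sqr_ge0//; lra.
have up : (2 + eta) * rph <= 6 * rp.
  rewrite -ler_sqr ?nnegrE ?mulr_ge0 ?(ltW rp0) ?(ltW rph0)//; try lra.
  rewrite !exprMn -rpE -rphE; apply: (@le_trans _ _ (9 * (2 * p))); last lra.
  by apply: ler_pM; rewrite ?sqr_ge0 ?(ltW ph0)//; nra.
set tau := (2 + eta) * (rn * rph); set lam := (2 + eta / 4) * (rn * rp).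
have tau_lam : eta / 4 * (rn * rp) <= tau - lam.
  by have := ler_wpM2l (ltW rn0) low; rewrite /tau /lam; lra.
have tau0 : 0 <= tau by rewrite /tau !mulr_ge0 ?(ltW rn0) ?(ltW rph0)//; lra.
have lam0 : 0 <= lam by rewrite /lam !mulr_ge0 ?(ltW rn0) ?(ltW rp0)//; lra.
have taule : tau <= 6 * (rn * rp) by have := ler_wpM2l (ltW rn0) up; rewrite /tau; lra.
have lamle : lam <= 3 * (rn * rp).
  by rewrite /lam ler_wpM2r ?mulr_ge0 ?(ltW rn0) ?(ltW rp0)//; lra.
rewrite thE -/lam in Nlam.
have [] := svd_threshold_bound (S := fun i => (2 + eta) * Num.sqrt (n%:R * phat) <= s i)
  U1 V1 s0 YE (ltW p0) rho0 lam0 tau0 g1 M1 Mg _ Nlam.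
  by move=> i; rewrite thhE.
rewrite -/T -/rn.
set m : R := #|_|%:R; set F := mxdot _ _; set rC := Num.sqrt #|C|%:R in Cc *.
have m0 : 0 <= m by rewrite /m ler0n.
have rC0 : 0 <= rC by exact: sqrtr_ge0.
move=> mle Fle.
have K0 : 0 <= 36 / eta by rewrite divr_ge0// ltW.
have rnC : rn ^+ 2 * rC + rho * rn ^+ 2 * rn <= (c1 + c2) * (eps * rn ^+ 3).
  apply: (@le_trans _ _ (rn ^+ 2 * (c1 * (rn * eps)) + c2 * eps * rn ^+ 2 * rn)).
    apply: lerD; first by rewrite ler_wpM2l// sqr_ge0.
    by rewrite ler_wpM2r ?(ltW rn0)// ler_wpM2r// sqr_ge0.
  by rewrite le_eqVlt; apply/orP; left; apply/eqP; ring.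
(* The number of values kept is at most [rp ^+ 2 * A] over the gap [eta / 4 * (rn * rp)], and
   [lam ^+ 2] is at most [9 * (rn * rp) ^+ 2]: hence [36 / eta]. The 9 is 6 + 3, from the bounds on
   [tau] and [lam]. *)
have F1 : F <= (36 / eta + 9) * (c1 + c2) * (eps * (rn ^+ 4 * rp ^+ 3)).
  apply: (le_trans Fle).
  set A := rn ^+ 2 * rC + rho * rn ^+ 2 * rn in rnC.
  have mle2 : m * (eta / 4 * (rn * rp)) <= rp ^+ 2 * A.
    by rewrite -rpE /A -rnE; apply: le_trans mle; rewrite ler_wpM2l.
  have mlam : m * lam ^+ 2 <= 36 / eta * (rn * rp * (rp ^+ 2 * A)).
    apply: (@le_trans _ _ (m * (3 * (rn * rp)) ^+ 2)).
      by rewrite ler_wpM2l// ler_sqr ?nnegrE// ?mulr_ge0 ?(ltW rn0) ?(ltW rp0).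
    have -> : m * (3 * (rn * rp)) ^+ 2 =
        36 / eta * (rn * rp * (m * (eta / 4 * (rn * rp)))).
      by field; rewrite gt_eqF.
    by rewrite ler_wpM2l// ler_wpM2l// mulr_ge0// ltW.
  have rest : p * ((tau + lam) * n%:R * rC) + rho * p ^+ 2 * n%:R ^+ 2 <=
      9 * (rn * rp * (rp ^+ 2 * A)).
    apply: (@le_trans _ _ (rp ^+ 2 * ((9 * (rn * rp)) * rn ^+ 2 * rC)
        + rho * rp ^+ 3 * rn ^+ 4)).
      rewrite {1}rpE rnE; apply: lerD.
        rewrite ler_wpM2l ?sqr_ge0// ler_wpM2r// ler_wpM2r ?sqr_ge0//; lra.
      have rp43 : rp ^+ 4 <= rp ^+ 3 by rewrite ler_wiXn2l// ltW.
      rewrite rpE -!exprM ler_wpM2r ?exprn_ge0 ?(ltW rn0)//.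
      by rewrite ler_wpM2l.
    have -> : 9 * (rn * rp * (rp ^+ 2 * A)) =
      rp ^+ 2 * ((9 * (rn * rp)) * rn ^+ 2 * rC) + 9 * (rho * rp ^+ 3 * rn ^+ 4).
      by rewrite /A; ring.
    rewrite lerD2l ler_peMl ?mulr_ge0 ?exprn_ge0 ?(ltW rn0) ?(ltW rp0)//; lra.
  rewrite -addrA; apply: (le_trans (lerD mlam rest)).
  rewrite -mulrDl -[leRHS]mulrA ler_wpM2l ?addr_ge0//.
  have -> : (c1 + c2) * (eps * (rn ^+ 4 * rp ^+ 3)) =
     rn * rp * (rp ^+ 2 * ((c1 + c2) * (eps * rn ^+ 3))) by ring.
  by rewrite ler_wpM2l ?mulr_ge0 ?(ltW rn0) ?(ltW rp0)// ler_wpM2l// sqr_ge0.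
have pph : 1 / phat ^+ 2 <= 2 / p ^+ 2.
  have p56 : 5 / 6 * p <= phat by nra.
  rewrite ler_pdivrMr ?exprn_gt0// mulrAC ler_pdivlMr ?exprn_gt0//; nra.
(* The factor 4 is 2 from the square of a sum times 2 from replacing [phat] by [p] in the
   denominator. *)
have entry i j : (map_mx (@truncate R) (usvt_W eta phat U s V) i j - M i j) ^+ 2 <=
   4 / p ^+ 2 * ((T - p *: M) i j * (T - p *: M) i j) + 4 * ((phat - p) ^+ 2 / p ^+ 2).
  rewrite mxE; apply: le_trans (truncate_contract _ (M1 i j)) _.
  rewrite /usvt_W gt_eqF// -/T [(phat^-1 *: T) i j]mxE.
  set z := (T - p *: M) i j.
  have -> : phat^-1 * T i j - M i j = (z + (p - phat) * M i j) / phat.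
    by rewrite /z !mxE; field; rewrite gt_eqF.
  rewrite exprMn exprVn -[_^-1]mul1r.
  have sq : (z + (p - phat) * M i j) ^+ 2 <= 2 * (z * z) + 2 * (phat - p) ^+ 2.
    apply: (@le_trans _ _ (2 * (z * z) + 2 * ((phat - p) ^+ 2 * M i j ^+ 2))).
      have := sqr_ge0 (z - (p - phat) * M i j); nra.
    rewrite lerD2l ler_wpM2l// ler_piMr ?sqr_ge0//.
    by rewrite -[leLHS]real_normK ?num_real// expr_le1.
  apply: (@le_trans _ _ ((2 * (z * z) + 2 * (phat - p) ^+ 2) * (2 / p ^+ 2))).
    by apply: ler_pM => //; rewrite ?sqr_ge0// divr_ge0// sqr_ge0.
  by rewrite le_eqVlt; apply/orP; left; apply/eqP; ring.
rewrite ler_pdivrMl ?exprn_gt0//.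
apply: (@le_trans _ _ (4 / p ^+ 2 * F + n%:R ^+ 2 * (4 * ((phat - p) ^+ 2 / p ^+ 2)))).
  have -> : n%:R ^+ 2 * (4 * ((phat - p) ^+ 2 / p ^+ 2)) =
     \sum_(i < n) \sum_(j < n) (4 * ((phat - p) ^+ 2 / p ^+ 2)).
    by rewrite !sumr_const card_ord -mulrnA -[RHS]mulr_natl natrM expr2.
  rewrite /F mxdotE big_distrr -big_split; apply: ler_sum => i _ /=.
  by rewrite big_distrr -big_split; apply: ler_sum => j _; exact: entry.
rewrite mulrDr lerD2r.
apply: (le_trans (ler_wpM2l _ F1)); first by rewrite divr_ge0// sqr_ge0.
rewrite rnE rpE le_eqVlt; apply/orP; left; apply/eqP; field.
by rewrite !gt_eqF.
Qed.

(** * Expectations of bounded functions and independence *)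

Section bounded_expectation.
Context (d : measure_display) (T : measurableType d) (R : realType)
  (P : probability T R).
Implicit Types (f g : T -> R) (A : set T).

(** Bounded everywhere: the class is closed under sums and products and all its members are
    integrable. *)
Definition bounded_measurable f :=
  measurable_fun setT f /\ exists B, forall w, `|f w| <= B.

Definition mean f : R := (\int[P]_w f w)%R.

Lemma bm_integrable f : bounded_measurable f ->
  P.-integrable setT (EFin \o f).
Proof.
move=> [mf [B fB]]; apply: measurable_bounded_integrable => //.
  by rewrite ltey_eq fin_num_measure.
exists B; split; first exact: num_real.
by move=> x Bx w _; apply: le_trans (fB w) (ltW Bx).
Qed.

Lemma bm_cst r : bounded_measurable (fun=> r).
Proof. by split; [exact: measurable_cst | exists `|r|]. Qed.

Lemma bmD f g : bounded_measurable f -> bounded_measurable g ->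
  bounded_measurable (fun w => f w + g w).
Proof.
move=> [mf [B fB]] [mg [C gC]]; split; first exact: measurable_funD.
exists (B + C) => w; apply: le_trans (ler_normD _ _) _; exact: lerD.
Qed.

Lemma bmM f g : bounded_measurable f -> bounded_measurable g ->
  bounded_measurable (fun w => f w * g w).
Proof.
move=> [mf [B fB]] [mg [C gC]]; split; first exact: measurable_funM.
exists (B * C) => w; rewrite normrM; exact: ler_pM.
Qed.

Lemma bmZ r f : bounded_measurable f -> bounded_measurable (fun w => r * f w).
Proof. by move=> mf; apply: bmM => //; exact: bm_cst. Qed.

Lemma bmB f g : bounded_measurable f -> bounded_measurable g ->
  bounded_measurable (fun w => f w - g w).
Proof.
move=> mf mg; rewrite (_ : (fun w => f w - g w) = (fun w => f w + (-1) * g w)).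
  by apply: bmD => //; exact: bmZ.
by apply/funext => w; rewrite mulN1r.
Qed.

Lemma bm_sum (I : Type) (s : seq I) (Q : pred I) (F : I -> T -> R) :
  (forall i, Q i -> bounded_measurable (F i)) ->
  bounded_measurable (fun w => \sum_(i <- s | Q i) F i w).
Proof.
move=> mF; elim: s => [|i s ih].
  have -> : (fun w => \sum_(j <- [::] | Q j) F j w) = fun=> 0.
    by apply/funext => w; rewrite big_nil.
  exact: bm_cst.
have -> : (fun w => \sum_(j <- i :: s | Q j) F j w) =
    fun w => (if Q i then F i w else 0) + \sum_(j <- s | Q j) F j w.
  by apply/funext => w; rewrite big_cons; case: ifP; rewrite ?add0r.
by apply: bmD => //; case: (boolP (Q i)) => Qi; [exact: mF|exact: bm_cst].
Qed.

Lemma bm_prod (I : Type) (s : seq I) (Q : pred I) (F : I -> T -> R) :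
  (forall i, Q i -> bounded_measurable (F i)) ->
  bounded_measurable (fun w => \prod_(i <- s | Q i) F i w).
Proof.
move=> mF; elim: s => [|i s ih].
  have -> : (fun w => \prod_(j <- [::] | Q j) F j w) = fun=> 1.
    by apply/funext => w; rewrite big_nil.
  exact: bm_cst.
have -> : (fun w => \prod_(j <- i :: s | Q j) F j w) =
    fun w => (if Q i then F i w else 1) * \prod_(j <- s | Q j) F j w.
  by apply/funext => w; rewrite big_cons; case: ifP; rewrite ?mul1r.
by apply: bmM => //; case: (boolP (Q i)) => Qi; [exact: mF|exact: bm_cst].
Qed.

Lemma bmX f m : bounded_measurable f -> bounded_measurable (fun w => f w ^+ m).
Proof.
move=> mf; elim: m => [|m ih].
  have -> : (fun w => f w ^+ 0) = fun=> 1 by apply/funext => w; rewrite expr0.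
  exact: bm_cst.
have -> : (fun w => f w ^+ m.+1) = fun w => f w * f w ^+ m.
  by apply/funext => w; rewrite exprS.
exact: bmM.
Qed.

Lemma bm_indic A : measurable A -> bounded_measurable (\1_A : T -> R).
Proof.
move=> mA; split; first exact: measurable_indic.
by exists 1 => w; rewrite indicE normr_nat lern1 leq_b1.
Qed.

Lemma meanD f g : bounded_measurable f -> bounded_measurable g ->
  mean (fun w => f w + g w) = mean f + mean g.
Proof. by move=> mf mg; rewrite /mean RintegralD//; exact: bm_integrable. Qed.

Lemma meanB f g : bounded_measurable f -> bounded_measurable g ->
  mean (fun w => f w - g w) = mean f - mean g.
Proof. by move=> mf mg; rewrite /mean RintegralB//; exact: bm_integrable. Qed.

Lemma meanZ r f : bounded_measurable f -> mean (fun w => r * f w) = r * mean f.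
Proof. by move=> mf; rewrite /mean RintegralZl//; exact: bm_integrable. Qed.

Lemma mean_cst r : mean (fun=> r) = r.
Proof. by rewrite /mean Rintegral_cst// [X in fine X](_ : _ = 1%E) ?mulr1//; exact: probability_setT. Qed.

Lemma mean_le f g : bounded_measurable f -> bounded_measurable g ->
  (forall w, f w <= g w) -> mean f <= mean g.
Proof. by move=> mf mg fg; apply: le_Rintegral => //; exact: bm_integrable. Qed.

Lemma mean_norm f B : bounded_measurable f -> (forall w, `|f w| <= B) ->
  `|mean f| <= B.
Proof.
move=> mf fB; rewrite ler_norml -[B in - B]mean_cst -[B in X in _ && X]mean_cst.
rewrite -mulN1r -meanZ; last exact: bm_cst.
apply/andP; split; apply: mean_le => //; try exact: bm_cst.
  by move=> w; have := fB w; rewrite mulN1r ler_norml => /andP[].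
by move=> w; have := fB w; rewrite ler_norml => /andP[].
Qed.

Lemma mean_sum (I : Type) (s : seq I) (Q : pred I) (F : I -> T -> R) :
  (forall i, Q i -> bounded_measurable (F i)) ->
  mean (fun w => \sum_(i <- s | Q i) F i w) = \sum_(i <- s | Q i) mean (F i).
Proof.
move=> mF; elim: s => [|i s ih].
  rewrite big_nil -[RHS](mean_cst 0); congr mean.
  by apply/funext => w; rewrite big_nil.
rewrite big_cons -ih; case: ifPn => Qi; last first.
  by congr mean; apply/funext => w; rewrite big_cons (negPf Qi).
rewrite -meanD; [|exact: mF|exact: bm_sum].
by congr mean; apply/funext => w; rewrite big_cons Qi.
Qed.

Lemma mean_indic A : measurable A -> mean \1_A = fine (P A).
Proof.
move=> mA; rewrite /mean /Rintegral; congr fine.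
by rewrite integral_indic// setIT.
Qed.

(** The sum counts the positive integers up to [y], so it is the integer part of [y]. *)
Lemma sum_levels_bounds (y : R) K : 0 <= y -> y <= K%:R ->
  \sum_(k < K) (k.+1%:R <= y)%R%:R <= y /\
  y <= \sum_(k < K) (k.+1%:R <= y)%R%:R + 1.
Proof.
elim: K y => [|K ih] y y0 yK.
  by rewrite big_ord0; split => //; rewrite add0r (le_trans yK).
rewrite big_ord_recl; have [y1|y1] := lerP 1 y.
  have E : \sum_(i < K) ((lift ord0 i).+1%:R <= y)%R%:R =
      \sum_(k < K) (k.+1%:R <= y - 1)%R%:R :> R.
    by apply: eq_bigr => k _; rewrite lift0 -natr1 lerBrDr.
  rewrite E /=; have [||l u] := ih (y - 1); first by rewrite subr_ge0.
    by rewrite lerBlDr natr1.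
  by split; lra.
rewrite big1 => [|i _]; first by rewrite !addr0 add0r; split => //; exact: ltW.
rewrite lift0 [X in (nat_of_bool X)%:R](_ : _ = false)//; apply/negbTE; rewrite -ltNge.
by apply: lt_le_trans y1 _; rewrite ler1n.
Qed.

(* Z is a uniform limit of affine combinations of indicators of its level sets. *)
Lemma mean_mul_levels (W Z : T -> R) c : bounded_measurable W ->
  bounded_measurable Z ->
  (forall t, mean (fun w => W w * \1_[set w | t <= Z w] w) =
             c * mean \1_[set w | t <= Z w]) ->
  mean W = c ->
  mean (fun w => W w * Z w) = c * mean Z.
Proof.
move=> bW bZ WZ Wc; have [mW [BW WB]] := bW; have [mZ [B0 ZB0]] := bZ.
pose B := `|B0| + 1.
have B_gt0 : 0 < B by rewrite ltr_wpDl.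
have ZB w : `|Z w| <= B.
  by apply: (le_trans (ZB0 w)); rewrite (le_trans (ler_norm _))// lerDl.
have mlev t : measurable [set w | t <= Z w].
  have -> : [set w | t <= Z w] = setT `&` Z @^-1` `[t, +oo[.
    by rewrite setTI; apply/seteqP; split => w /=; rewrite in_itv/= andbT.
  by apply: mZ.
have bound K : (0 < K)%N ->
    `|mean (fun w => W w * Z w) - c * mean Z| <= (BW + `|c|) * (2 * B / K%:R).
  move=> K0; pose h := 2 * B / K%:R.
  have KR : (0 : R) < K%:R by rewrite ltr0n.
  have h0 : 0 < h by rewrite divr_gt0// mulr_gt0.
  pose lev k := [set w | k.+1%:R * h - B <= Z w].
  (* [ZK] is [Z] rounded down to the grid of mesh [h] that starts at [- B]. *)
  pose ZK w := \sum_(k < K) h * \1_(lev k) w - B.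
  have bl k : bounded_measurable (\1_(lev k) : T -> R) by apply: bm_indic; exact: mlev.
  have bZK : bounded_measurable ZK.
    apply: bmB; last exact: bm_cst.
    by apply: bm_sum => k _; apply: bmZ.
  have err w : `|Z w - ZK w| <= h.
    have := ZB w; rewrite ler_norml => /andP[ZN ZP].
    have y0 : 0 <= (Z w + B) / h by rewrite divr_ge0 ?(ltW h0)//; lra.
    have yK : (Z w + B) / h <= K%:R.
      rewrite ler_pdivrMr// /h mulrCA divff ?gt_eqF// mulr1; lra.
    have [l u] := sum_levels_bounds y0 yK.
    have E : \sum_(k < K) (k.+1%:R <= (Z w + B) / h)%R%:R =
        \sum_(k < K) \1_(lev k) w :> R.
      apply: eq_bigr => k _; rewrite indicE; congr (nat_of_bool _)%:R.
      rewrite ler_pdivlMr// -lerBlDr.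
      by apply/idP/idP; rewrite inE.
    move: l u; rewrite E ler_pdivlMr// ler_pdivrMr// mulrDl mul1r.
    move=> l u; rewrite /ZK -big_distrr/= ler_norml; apply/andP; split; lra.
  have EZ : mean (fun w => W w * ZK w) = c * mean ZK.
    have -> : (fun w => W w * ZK w) = (fun w => \sum_(k < K)
        h * (W w * \1_(lev k) w) - B * W w).
      apply/funext => w; rewrite /ZK mulrBr mulrC [B * _]mulrC; congr (_ - _).
      by rewrite big_distrl/=; apply: eq_bigr => k _; ring.
    rewrite meanB; [|apply: bm_sum => k _; apply: bmZ; exact: bmM|exact: bmZ].
    rewrite /ZK meanB; [|by apply: bm_sum => k _; exact: bmZ|exact: bm_cst].
    rewrite !mean_sum; [|by move=> k _; apply: bmZ|
      by move=> k _; apply: bmZ; apply: bmM].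
    rewrite meanZ// mean_cst Wc mulrBr [B * c]mulrC; congr (_ - _).
    rewrite big_distrr; apply: eq_bigr => k _ /=.
    by rewrite !meanZ//; [rewrite WZ mulrCA|apply: bmM].
  have -> : mean (fun w => W w * Z w) - c * mean Z =
      mean (fun w => W w * (Z w - ZK w)) - c * mean (fun w => Z w - ZK w).
    have -> : (fun w => W w * (Z w - ZK w)) = fun w => W w * Z w - W w * ZK w.
      by apply/funext => w; rewrite mulrBr.
    by rewrite (meanB bZ bZK) (meanB (bmM bW bZ) (bmM bW bZK)) EZ; ring.
  apply: le_trans (ler_normB _ _) _; rewrite mulrDl normrM.
  apply: lerD.
    apply: mean_norm; first by apply: bmM => //; exact: bmB.
    by move=> w; rewrite normrM; apply: ler_pM.
  by rewrite ler_wpM2l// mean_norm//; exact: bmB.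
apply/eqP; rewrite -subr_eq0 -normr_eq0 eq_le normr_ge0 andbT.
apply/ler_addgt0Pr => e e0; rewrite add0r.
set x := `|_ - _| in bound *; set b := (BW + _) in bound.
have b0 : 0 <= b.
  rewrite addr_ge0//; apply: le_trans (WB point); exact: normr_ge0.
pose K := (Num.truncn (b * (2 * B) / e)).+1.
have K0 : (0 < K)%N by [].
apply: (le_trans (bound K K0)).
rewrite mulrA ler_pdivrMr ?ltr0n// [e * _]mulrC -ler_pdivrMr// ltW//.
exact: truncnS_gt.
Qed.

(** Independence is stated for events. Applying it to level sets is enough to reach bounded
    functions, without a monotone class argument. *)
Lemma mean_prod_independent (I : finType) (D : {set I})
    (F : I -> set (set T)) (Z : I -> T -> R) :
  mutually_independent P D F ->
  (forall i, i \in D -> bounded_measurable (Z i)) ->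
  (forall i t, i \in D -> F i [set w | t <= Z i w]) ->
  mean (fun w => \prod_(i in D) Z i w) = \prod_(i in D) mean (Z i).
Proof.
move=> ind bZ FZ.
have mlev i t : i \in D -> measurable [set w | t <= Z i w].
  move=> iD; have [mZ _] := bZ i iD.
  have -> : [set w | t <= Z i w] = setT `&` Z i @^-1` `[t, +oo[.
    by rewrite setTI; apply/seteqP; split => w /=; rewrite in_itv/= andbT.
  by apply: mZ.
(* The factors Z i are replaced one at a time by indicators of level sets. *)
suff H (s : seq I) (J : {set I}) (t : I -> R) : uniq s ->
    (forall i, i \in s -> (i \in D) && (i \notin J)) -> J \subset D ->
    mean (fun w => \prod_(i <- s) Z i w * \prod_(i in J) \1_[set w | t i <= Z i w] w) =
    \prod_(i <- s) mean (Z i) * \prod_(i in J) mean \1_[set w | t i <= Z i w].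
  have := H (enum D) finset.set0 (fun=> 0) (enum_uniq _).
  rewrite big_set0 mulr1 big_enum => <-; last exact: finset.sub0set.
    by congr mean; apply/funext => w; rewrite big_set0 mulr1 big_enum.
  by move=> i; rewrite mem_enum finset.in_set0 => ->.
elim: s J t => [|i s ih] J t.
  move=> _ _ JD; rewrite big_nil mul1r.
  have -> : (fun w => \prod_(i <- [::]) Z i w *
      \prod_(i in J) \1_[set w | t i <= Z i w] w) =
      \1_(\bigcap_(i in [set` J]) [set w | t i <= Z i w]) :> (T -> R).
    apply/funext => w; rewrite big_nil mul1r indicE.
    case: (boolP (w \in _)); rewrite (inE, notin_setE) /=.
      move=> wJ; rewrite big1// => i iJ; rewrite indicE mem_set//.
      exact: wJ.
    move=> wJ; have [/existsP[i /andP[iJ ti]]|] := boolP [exists i, (i \in J) && ~~ (t i <= Z i w)].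
      rewrite (bigD1 i)//= indicE memNset ?mul0r//.
      exact/negP.
    rewrite negb_exists => /forallP all; exfalso; apply: wJ => i /= iJ.
    by have := all i; rewrite iJ /= negbK.
  rewrite mean_indic; last first.
    apply: fin_bigcap_measurable => // i /= iJ.
    by apply: mlev; move/fintype.subsetP: JD; apply.
  rewrite ind//; last first.
    by move=> i iJ; apply: FZ; move/fintype.subsetP: JD; apply.
  transitivity (fine (\prod_(i in J) (mean \1_[set w | t i <= Z i w])%:E)%E).
    congr fine; apply: eq_bigr => i iJ.
    have mi : measurable [set w | t i <= Z i w].
      by apply: mlev; move/fintype.subsetP: JD; apply.
    by rewrite mean_indic// fineK//; exact: fin_num_measure.
  by rewrite prodEFin.
move=> /= /andP[iNs us] sD JD.
have /andP[iD iJ] : (i \in D) && (i \notin J) by apply: sD; rewrite inE eqxx.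
have sD' j : j \in s -> (j \in D) && (j \notin J).
  by move=> js; apply: sD; rewrite inE js orbT.
rewrite big_cons -mulrA [RHS]mulrC.
set c := _ * _.
have bI (J' : {set I}) t' : J' \subset D ->
    bounded_measurable (fun w => \prod_(i in J') (\1_[set w | t' i <= Z i w] w : R)).
  move=> J'D; apply: bm_prod => j jJ; apply: bm_indic; apply: mlev.
  by move/fintype.subsetP: J'D; apply.
have bs : bounded_measurable (fun w => \prod_(i <- s) Z i w).
  elim: (s) sD' => [|j s' ih'] sD'.
    have -> : (fun w => \prod_(i <- [::]) Z i w) = fun=> 1.
      by apply/funext => w; rewrite big_nil.
    exact: bm_cst.
  have -> : (fun w => \prod_(i <- j :: s') Z i w) =
      fun w => Z j w * \prod_(i <- s') Z i w.
    by apply/funext => w; rewrite big_cons.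
  apply: bmM; first by have /andP[/bZ] := sD' j (mem_head _ _).
  by apply: ih' => k ks; apply: sD'; rewrite inE ks orbT.
have -> : (fun w => \prod_(j <- i :: s) Z j w *
      \prod_(i in J) \1_[set w | t i <= Z i w] w) =
    (fun w => (\prod_(j <- s) Z j w * \prod_(i in J) \1_[set w | t i <= Z i w] w) * Z i w).
  by apply/funext => w; rewrite big_cons; ring.
apply: mean_mul_levels; [by apply: bmM => //; exact: bI|exact: bZ| |exact: ih].
move=> u; pose t' j := if j == i then u else t j.
have e1 (G : R -> I -> R) : \prod_(j in i |: J) G (t' j) j =
    G u i * \prod_(j in J) G (t j) j.
  rewrite big_setU1//= /t' eqxx; congr (_ * _); apply: eq_bigr => j jJ.
  by case: eqP => // ji; rewrite -ji jJ in iJ.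
have := ih (i |: J)%SET t' us _ _; rewrite (e1 (fun x j => mean \1_[set w | x <= Z j w])).
rewrite /c mulrA [X in _ = X]mulrAC => <-.
- congr mean; apply/funext => w; rewrite (e1 (fun x j => \1_[set w | x <= Z j w] w)).
  by ring.
- move=> j js; have /andP[jD jJ] := sD' j js; rewrite jD !inE negb_or jJ andbT.
  by apply: contraNneq iNs => <-.
- by rewrite finset.subUset JD andbT finset.sub1set.
Qed.

End bounded_expectation.

(** * Moments of the noise *)

Lemma measurable_truncate (R : realType) : measurable_fun setT (@truncate R).
Proof.
have -> : @truncate R = (fun x => Num.max (-1) (Num.min x 1)).
  apply/funext => x; rewrite /truncate; case: ltP => x1.
    by rewrite max_r//; lra.
  by case: ltP.
by apply: measurable_maxr => //; exact: measurable_minr.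
Qed.

Section entries.
Context (d : measure_display) (T : measurableType d) (R : realType)
  (P : probability T R) (n : nat) (D : {set 'I_n * 'I_n}) (M : 'M[R]_n) (p : R)
  (X : 'I_n -> 'I_n -> {RV P >-> R}) (O : 'I_n -> 'I_n -> {RV P >-> bool}).
Hypothesis model : entry_model D M p X O.
Hypothesis p01 : 0 < p <= 1.
Hypothesis M1 : forall i j, `|M i j| <= 1.
Local Notation I := ('I_n * 'I_n)%type.

(** The common form of the noise, of its powers and of the centred observation indicator, so that
    one product formula serves all of them. *)
Definition observation_value (alpha : R -> R) (gamma : R) (e : I) (w : T) : R :=
  if O e.1 e.2 w then alpha (X e.1 e.2 w) else gamma.

Definition bounded_borel (alpha : R -> R) :=
  measurable_fun setT alpha /\ exists B, forall x, `|alpha x| <= B.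

Section product.
Variables (alpha : I -> R -> R) (gamma : I -> R).
Hypothesis ba : forall e, bounded_borel (alpha e).

(** An [observation_value] mixes two independent variables. It is split over the value [b] of the
    indicator into products of a function of [X] and a function of [O]. *)
Let zl (e : I) (b : bool) (w : T) : R := if b then alpha e (X e.1 e.2 w) else gamma e.
Let zr (e : I) (b : bool) (w : T) : R := (O e.1 e.2 w == b)%:R.

Let bm_zl e b : bounded_measurable (zl e b).
Proof.
case: b; last exact: bm_cst.
have [ma [B aB]] := ba e; split; last by exists B => w; exact: aB.
exact: measurableT_comp.
Qed.

Let bm_zr e b : bounded_measurable (zr e b).
Proof.
split; last by exists 1 => w; rewrite normr_nat lern1 leq_b1.
have mb : measurable_fun setT (fun c : bool => (c == b)%:R : R) by [].
exact: (measurableT_comp mb).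
Qed.

Let obsE e w : observation_value (alpha e) (gamma e) e w =
  \sum_(b : bool) zl e b w * zr e b w.
Proof.
rewrite /observation_value big_bool /zl /zr.
by case: (O _ _ w); rewrite /= ?mulr1 ?mulr0 ?addr0 ?add0r.
Qed.

Lemma bm_observation_value e : bounded_measurable (observation_value (alpha e) (gamma e) e).
Proof.
rewrite (_ : observation_value _ _ e = fun w => \sum_(b : bool) zl e b w * zr e b w).
  by apply: bm_sum => b _; exact: bmM.
by apply/funext => w; rewrite obsE.
Qed.

Let z (phi : I -> bool) (s : I + I) (w : T) : R :=
  match s with inl e => zl e (phi e) w | inr e => zr e (phi e) w end.

Let level_sigma phi s t : generated_sigma X O s [set w | t <= z phi s w].
Proof.
have nicel (A : set R) (e : I) : measurable A ->
    generated_sigma X O (inl e) (X e.1 e.2 @^-1` A).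
  by move=> mA; exists A => //; rewrite setTI.
have nicer (A : set bool) (e : I) :
    generated_sigma X O (inr e) (O e.1 e.2 @^-1` A).
  by exists A => //; rewrite setTI.
case: s => e /=; last exact: (nicer [set b | t <= (b == phi e)%:R] e).
rewrite /zl; case: (phi e); last first.
  apply: (nicel [set x | t <= gamma e]).
  have [tg|tg] := boolP (t <= gamma e).
    by rewrite (_ : [set _ | _] = setT)//; apply/seteqP; split.
  by rewrite (_ : [set _ | _] = set0)//; apply/seteqP; split.
apply: (nicel [set x | t <= alpha e x]).
have -> : [set x | t <= alpha e x] = setT `&` alpha e @^-1` `[t, +oo[.
  by rewrite setTI; apply/seteqP; split => x /=; rewrite in_itv/= andbT.
by have [ma _] := ba e; exact: ma.
Qed.

Let DD : {set I + I} :=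
  [set s | match s with inl ij => ij \in D | inr ij => ij \in D end]%SET.

Let mean_z phi (J : {set I + I}) : J \subset DD ->
  mean P (fun w => \prod_(s in J) z phi s w) = \prod_(s in J) mean P (z phi s).
Proof.
move=> JD; apply: (mean_prod_independent (F := generated_sigma X O)).
- move=> K E KJ; apply: (entry_independent model).
  exact: fintype.subset_trans JD.
- by case=> e _; [exact: bm_zl|exact: bm_zr].
- by move=> s t _; exact: level_sigma.
Qed.

Let mean_zlr e b : e \in D ->
  mean P (fun w => zl e b w * zr e b w) = mean P (zl e b) * mean P (zr e b).
Proof.
move=> eD; have JD : [set inl e; inr e]%SET \subset DD.
  by apply/fintype.subsetP => s; rewrite !inE => /orP[]/eqP ->.
have := mean_z (fun=> b) JD; rewrite big_setU1 ?big_set1/= ?inE// => <-.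
by congr mean; apply/funext => w; rewrite big_setU1 ?big_set1/= ?inE.
Qed.

Lemma mean_zr_true e : e \in D -> mean P (zr e true) = p.
Proof.
move=> eD; have mO : measurable [set w | O e.1 e.2 w].
  have -> : [set w | O e.1 e.2 w] = setT `&` O e.1 e.2 @^-1` [set true].
    by rewrite setTI; apply/seteqP; split => w /=; case: (O _ _ w).
  exact: measurable_funPT.
have -> : zr e true = \1_[set w | O e.1 e.2 w].
  apply/funext => w; rewrite /zr indicE; congr (nat_of_bool _)%:R.
  by apply/idP/idP; rewrite inE/= => /eqP.
have -> := mean_indic P mO.
have e12 : (e.1, e.2) \in D by rewrite -surjective_pairing.
by rewrite (entry_observed model e12).
Qed.

Lemma mean_observation_value e : e \in D ->
  mean P (observation_value (alpha e) (gamma e) e) =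
  p * mean P (fun w => alpha e (X e.1 e.2 w)) + (1 - p) * gamma e.
Proof.
move=> eD.
have -> : observation_value (alpha e) (gamma e) e =
    fun w => \sum_(b : bool) zl e b w * zr e b w.
  by apply/funext => w; rewrite obsE.
rewrite mean_sum; last by move=> b _; exact: bmM.
rewrite big_bool !mean_zlr// mean_zr_true// mulrC; congr (_ + _).
rewrite -[zl e false]/(fun=> gamma e) mean_cst mulrC; congr (_ * _).
rewrite -(mean_zr_true eD) -[X in _ = X - _](mean_cst P) -meanB//; last exact: bm_cst.
by congr mean; apply/funext => w; rewrite /zr; case: (O _ _ w) => /=; rewrite ?subrr ?subr0.
Qed.

(** The product of the two-term sums is expanded over all observation patterns [phi]. For a fixed
    pattern the factors are independent, and the sum of the resulting products is factored back. *)
Lemma mean_prod_observation :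
  mean P (fun w => \prod_(e in D) observation_value (alpha e) (gamma e) e w) =
  \prod_(e in D) mean P (observation_value (alpha e) (gamma e) e).
Proof.
have EG e : e \in D -> mean P (observation_value (alpha e) (gamma e) e) =
    \sum_(b : bool) mean P (zl e b) * mean P (zr e b).
  move=> eD; have -> : observation_value (alpha e) (gamma e) e =
      fun w => \sum_(b : bool) zl e b w * zr e b w.
    by apply/funext => w; rewrite obsE.
  rewrite mean_sum; last by move=> b _; exact: bmM.
  by apply: eq_bigr => b _; exact: mean_zlr.
(* The default [false] fixes [phi] outside [D], so that each pattern on [D] occurs once. *)
rewrite (eq_bigr _ EG) (big_distr_big false).
have -> : (fun w => \prod_(e in D) observation_value (alpha e) (gamma e) e w) =
    fun w => \sum_(phi in pffun_on false (mem D) xpredT)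
      \prod_(e in D) (zl e (phi e) w * zr e (phi e) w).
  apply/funext => w; under eq_bigr do rewrite obsE.
  exact: (big_distr_big false).
rewrite mean_sum; last by move=> phi _; apply: bm_prod => e _; exact: bmM.
apply: eq_bigr => phi _.
have prodE (g : I + I -> R) : \prod_(e in D) (g (inl e) * g (inr e)) =
    \prod_(s in DD) g s.
  rewrite big_split big_sumType/=.
  by congr (_ * _); apply: eq_bigl => e; rewrite inE.
rewrite (prodE (fun s => mean P (z phi s))) -mean_z//.
by congr mean; apply/funext => w; rewrite -(prodE (fun s => z phi s w)).
Qed.

End product.

(* The truncation makes the noise bounded everywhere and not only almost
   everywhere. *)
Definition noise (e : I) (w : T) : R :=
  observation_value (fun x => truncate x - p * M e.1 e.2) (- (p * M e.1 e.2)) e w.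

Lemma noiseXE m e w : noise e w ^+ m =
  observation_value (fun x => (truncate x - p * M e.1 e.2) ^+ m)
    ((- (p * M e.1 e.2)) ^+ m) e w.
Proof. by rewrite /noise /observation_value; case: ifP. Qed.

Lemma pM_le e : `|p * M e.1 e.2| <= 1.
Proof.
have /andP[p0 p1] := p01.
by rewrite normrM mulr_ile1// ger0_norm// ltW.
Qed.

Lemma bounded_borel_noise e m :
  bounded_borel (fun x => (truncate x - p * M e.1 e.2) ^+ m).
Proof.
split.
  apply: measurable_funX; apply: measurable_funB => //.
  exact: measurable_truncate.
exists (2 ^+ m) => x; rewrite normrX lerXn2r ?nnegrE//.
apply: le_trans (ler_normB _ _) _.
by have := truncate_norm x; have := pM_le e; lra.
Qed.

Lemma bm_noiseX e m : bounded_measurable (fun w => noise e w ^+ m).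
Proof.
have := bm_observation_value (fun e => (- (p * M e.1 e.2)) ^+ m)
  (fun e => bounded_borel_noise e m) e.
by congr bounded_measurable; apply/funext => w; rewrite noiseXE.
Qed.

Lemma bm_noise e : bounded_measurable (noise e).
Proof. exact: (bm_noiseX e 1). Qed.

Lemma noise_le2 e w : `|noise e w| <= 2.
Proof.
rewrite /noise /observation_value; case: ifP => _.
  apply: le_trans (ler_normB _ _) _.
  by have := truncate_norm (X e.1 e.2 w); have := pM_le e; lra.
by rewrite normrN (le_trans (pM_le e))// ler1n.
Qed.

Lemma mean_prod_noise (m : I -> nat) :
  mean P (fun w => \prod_(e in D) noise e w ^+ m e) =
  \prod_(e in D) mean P (fun w => noise e w ^+ m e).
Proof.
have := mean_prod_observation (fun e => (- (p * M e.1 e.2)) ^+ m e)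
  (fun e => bounded_borel_noise e (m e)).
have E e : observation_value (fun x => (truncate x - p * M e.1 e.2) ^+ m e)
    ((- (p * M e.1 e.2)) ^+ m e) e = (fun w => noise e w ^+ m e).
  by apply/funext => w; rewrite noiseXE.
under [X in _ = X]eq_bigr do rewrite E; move=> <-.
by congr mean; apply/funext => w; apply: eq_bigr => e _; rewrite noiseXE.
Qed.

Lemma truncate_id (x : R) : `|x| <= 1 -> truncate x = x.
Proof.
rewrite ler_norml => /andP[x1 x2]; rewrite /truncate ltNge x2 /=.
by rewrite ltNge x1.
Qed.

Lemma mean_truncate e : e \in D ->
  mean P (fun w => truncate (X e.1 e.2 w)) = M e.1 e.2.
Proof.
move=> eD; have e12 : (e.1, e.2) \in D by rewrite -surjective_pairing.
have := entry_mean model e12; rewrite expectation_def => XM.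
rewrite /mean /Rintegral -[RHS]/(fine (M e.1 e.2)%:E) -XM; congr fine.
apply: ae_eq_integral => //.
- apply/measurable_EFinP; apply: measurableT_comp => //.
  exact: measurable_truncate.
- exact/measurable_EFinP.
apply: filterS (entry_bounded model e12) => w /= Xw _.
by rewrite truncate_id.
Qed.

Lemma mean_noise e : e \in D -> mean P (noise e) = 0.
Proof.
move=> eD.
have := mean_observation_value (fun e => (- (p * M e.1 e.2)) ^+ 1)
  (fun e => bounded_borel_noise e 1) eD.
rewrite -/(noise e) => ->.
have -> : (fun w => (truncate (X e.1 e.2 w) - p * M e.1 e.2) ^+ 1) =
    fun w => truncate (X e.1 e.2 w) - p * M e.1 e.2 by [].
rewrite meanB; last exact: bm_cst; last first.
  split; last by exists 1 => w; exact: truncate_norm.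
  by apply: measurableT_comp => //; exact: measurable_truncate.
by rewrite mean_truncate// mean_cst; ring.
Qed.

(** The value is [p] times the second moment of the truncated entry, minus
    [(p * M e.1 e.2) ^+ 2]. *)
Lemma mean_noise_sqr e : e \in D -> mean P (fun w => noise e w ^+ 2) <= p.
Proof.
move=> eD; have /andP[p0 p1] := p01.
have bt : bounded_measurable (fun w => truncate (X e.1 e.2 w)).
  split; last by exists 1 => w; exact: truncate_norm.
  by apply: measurableT_comp => //; exact: measurable_truncate.
have := mean_observation_value (fun e => (- (p * M e.1 e.2)) ^+ 2)
  (fun e => bounded_borel_noise e 2) eD.
have -> : observation_value (fun x => (truncate x - p * M e.1 e.2) ^+ 2)
    ((- (p * M e.1 e.2)) ^+ 2) e = (fun w => noise e w ^+ 2).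
  by apply/funext => w; rewrite noiseXE.
move=> ->; set m := M e.1 e.2.
have -> : (fun w => (truncate (X e.1 e.2 w) - p * m) ^+ 2) =
    fun w => (truncate (X e.1 e.2 w)) ^+ 2 - (2 * p * m) * truncate (X e.1 e.2 w) + (p * m) ^+ 2.
  by apply/funext => w; ring.
rewrite meanD; [|by apply: bmB; [exact: bmX|exact: bmZ]|exact: bm_cst].
rewrite meanB; [|exact: bmX|exact: bmZ].
rewrite meanZ// mean_truncate// mean_cst -/m.
have : mean P (fun w => truncate (X e.1 e.2 w) ^+ 2) <= 1.
  apply: le_trans (ler_norm _) _; apply: mean_norm; first exact: bmX.
  by move=> w; rewrite normrX exprn_ile1// truncate_norm.
move: (mean _ _) => a a1.
have -> : p * (a - 2 * p * m * m + (p * m) ^+ 2) + (1 - p) * (- (p * m)) ^+ 2 =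
  p * a - (p * m) ^+ 2 by ring.
have := sqr_ge0 (p * m); nra.
Qed.

Lemma mean_noiseX_le e m : `|mean P (fun w => noise e w ^+ m)| <= 2 ^+ m.
Proof.
apply: mean_norm => [|w]; first exact: bm_noiseX.
by rewrite normrX lerXn2r ?nnegrE// noise_le2.
Qed.

Lemma mean_noiseX2_le e m : e \in D ->
  `|mean P (fun w => noise e w ^+ m.+2)| <= p * 2 ^+ m.
Proof.
move=> eD; have h w : `|noise e w ^+ m.+2| <= 2 ^+ m * noise e w ^+ 2.
  rewrite -addn2 exprD normrM [`|noise e w ^+ 2|]ger0_norm ?sqr_ge0//.
  by rewrite ler_wpM2r ?sqr_ge0// normrX lerXn2r ?nnegrE// noise_le2.
have b2 := bm_noiseX e 2.
apply: (@le_trans _ _ (mean P (fun w => 2 ^+ m * noise e w ^+ 2))).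
  rewrite ler_norml -mulN1r -meanZ; last exact: bmZ.
  apply/andP; split; apply: mean_le; try (exact: bm_noiseX); try exact: bmZ.
  - by apply: bmZ; exact: bmZ.
  - by move=> w; have := h w; rewrite mulN1r ler_norml => /andP[].
  - by move=> w; apply: le_trans (ler_norm _) (h w).
by rewrite meanZ// mulrC ler_wpM2r ?exprn_ge0//; exact: mean_noise_sqr.
Qed.

(** * Deviation of the proportion of observed entries *)

Definition obs_dev (e : I) (w : T) : R := observation_value (fun=> 1 - p) (- p) e w.

Lemma bounded_borel_cst r : bounded_borel (fun=> r).
Proof. by split => //; exists `|r|. Qed.

Lemma bm_obs_dev e : bounded_measurable (obs_dev e).
Proof.
exact: (bm_observation_value (fun=> - p) (fun=> bounded_borel_cst (1 - p)) e).
Qed.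

Lemma mean_obs_devM e e' : e \in D -> e' \in D ->
  mean P (fun w => obs_dev e w * obs_dev e' w) <= (e == e')%:R * p.
Proof.
move=> eD eD'; have /andP[p0 p1] := p01.
have [<-|ee'] := eqVneq e e'.
  rewrite mul1r.
  have -> : (fun w => obs_dev e w * obs_dev e w) =
      observation_value (fun=> (1 - p) ^+ 2) ((- p) ^+ 2) e.
    apply/funext => w; rewrite /obs_dev /observation_value.
    by case: ifP; rewrite expr2.
  rewrite (mean_observation_value (fun=> (- p) ^+ 2)
    (fun=> bounded_borel_cst ((1 - p) ^+ 2)) eD) mean_cst.
  have -> : p * (1 - p) ^+ 2 + (1 - p) * (- p) ^+ 2 = p - p ^+ 2 by ring.
  by rewrite lerBlDr lerDl sqr_ge0.
rewrite mul0r.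
(* Setting the other factors to 1 turns the product formula over [D] into one for the two entries
   [e] and [e']. *)
pose a (f : I) : R := if (f == e) || (f == e') then 1 - p else 1.
pose g (f : I) : R := if (f == e) || (f == e') then - p else 1.
have := @mean_prod_observation (fun f => (fun=> a f)) g (fun f => bounded_borel_cst (a f)).
have -> : (fun w => \prod_(f in D) observation_value (fun=> a f) (g f) f w) =
    fun w => obs_dev e w * obs_dev e' w.
  apply/funext => w; rewrite (bigD1 e)//= (bigD1 e')/=; last by rewrite eq_sym ee' eD'.
  rewrite big1 ?mulr1 => [|f /andP[/andP[_ fe] fe']].
    by rewrite /obs_dev /observation_value /a /g !eqxx orbT.
  by rewrite /observation_value /a /g (negPf fe) (negPf fe') /=; case: ifP.
move=> ->; rewrite (bigD1 e)//=.
rewrite (@mean_observation_value (fun f => (fun=> a f)) g (fun f => bounded_borel_cst (a f)) e eD).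
rewrite mean_cst /a /g eqxx /=.
by rewrite (_ : p * (1 - p) + (1 - p) * - p = 0) ?mul0r//; ring.
Qed.

Lemma mean_obs_dev_sum : (0 < #|D|)%N ->
  mean P (fun w => (#|D|%:R^-1 * \sum_(e in D) obs_dev e w) ^+ 2) <= p / #|D|%:R.
Proof.
move=> D0; have DR : (0 : R) < #|D|%:R by rewrite ltr0n.
have -> : (fun w => (#|D|%:R^-1 * \sum_(e in D) obs_dev e w) ^+ 2) =
   fun w => (#|D|%:R^-1) ^+ 2 * \sum_(e in D) \sum_(e' in D) obs_dev e w * obs_dev e' w.
  apply/funext => w; rewrite exprMn; congr (_ * _).
  by rewrite expr2 big_distrlr.
have bp e e' := bmM (bm_obs_dev e) (bm_obs_dev e').
rewrite meanZ; last by apply: bm_sum => e _; exact: bm_sum.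
rewrite mean_sum; last by move=> e _; exact: bm_sum.
apply: (@le_trans _ _ (#|D|%:R^-1 ^+ 2 * \sum_(e in D) p)).
  rewrite ler_wpM2l ?sqr_ge0//; apply: ler_sum => e eD.
  rewrite mean_sum//.
  apply: (@le_trans _ _ (\sum_(e' in D) (e == e')%:R * p)).
    by apply: ler_sum => e' eD'; exact: mean_obs_devM.
  rewrite (bigD1 e)//= eqxx mul1r big1 ?addr0// => e' /andP[_].
  by rewrite eq_sym => /negPf ->; rewrite mul0r.
rewrite sumr_const -[p *+ _]mulr_natr le_eqVlt; apply/orP; left; apply/eqP.
by field; rewrite gt_eqF.
Qed.

(** A single measurable null set for all entries, so that its indicator can enter the majorant of
    the error. *)
Lemma entry_bounded_null : exists A : set T, [/\ measurable A, P A = 0%E &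
  forall w, ~ A w -> forall i j, (i, j) \in D -> `|X i j w| <= 1].
Proof.
have H : P.-negligible (~` [set w | forall e : I, e \in D -> `|X e.1 e.2 w| <= 1]).
  have : {ae P, forall w, forall e : I, e \in D -> `|X e.1 e.2 w| <= 1}.
    apply: filter_forall => e; case: (boolP (e \in D)) => eD; last first.
      by apply: aeW.
    have e12 : (e.1, e.2) \in D by rewrite -surjective_pairing.
    by apply: filterS (entry_bounded model e12).
  by [].
have [A [mA PA HA]] := H; exists A; split => // w Aw i j ijD.
apply: contrapT => Xw; apply: Aw; apply: HA => /= h; apply: Xw.
exact: (h (i, j) ijD).
Qed.

End entries.

(** * The norm of the noise matrix *)

(** A k-th root is taken in [kernel_mul_trace]. *)
Lemma kernel_contract (R : realFieldType) (V : finType) (H : V -> V -> R)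
    (k : nat) (lam : R) (u : V -> R) :
  (forall x y, H x y = H y x) -> (0 < k)%N -> 0 <= lam ->
  \sum_x kernel_pow H k.*2 x x <= lam ^+ k.*2 ->
  \sum_x kernel_mul H u x ^+ 2 <= lam ^+ 2 * \sum_x u x ^+ 2.
Proof.
move=> HC k0 lam0 tr; have u0 : 0 <= \sum_x u x ^+ 2.
  by apply: sumr_ge0 => x _; exact: sqr_ge0.
have Hu0 : 0 <= \sum_x kernel_mul H u x ^+ 2.
  by apply: sumr_ge0 => x _; exact: sqr_ge0.
rewrite -(ler_pXn2r k0) ?nnegrE ?mulr_ge0 ?sqr_ge0//.
apply: le_trans (kernel_mul_trace HC u k0) _.
rewrite exprMn mulrC -exprM mul2n ler_wpM2r// exprn_ge0//.
Qed.

Section trace_moment.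
Context (d : measure_display) (T : measurableType d) (R : realType)
  (P : probability T R) (n : nat) (D : {set 'I_n * 'I_n}) (M : 'M[R]_n) (p : R)
  (X : 'I_n -> 'I_n -> {RV P >-> R}) (O : 'I_n -> 'I_n -> {RV P >-> bool}).
Hypothesis model : entry_model D M p X O.
Hypothesis p01 : 0 < p <= 1.
Hypothesis M1 : forall i j, `|M i j| <= 1.
Variables (V : finType) (adj : rel V) (ed : V -> V -> 'I_n * 'I_n).
Hypothesis adjC : symmetric adj.
Hypothesis edC : forall x y, ed x y = ed y x.
Hypothesis ed_inj : forall x y x' y', adj x y -> adj x' y' ->
  ed x y = ed x' y' -> (x = x' /\ y = y') \/ (x = y' /\ y = x').
Hypothesis edD : forall x y, adj x y -> ed x y \in D.
Hypothesis adj_le : forall y, (#|[set x | adj y x]%SET| <= n)%N.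

Definition noise_kernel (w : T) (x y : V) : R :=
  if adj x y then noise M p X O (ed x y) w else 0.

Definition noise_trace k (w : T) : R := \sum_x kernel_pow (noise_kernel w) k x x.

Lemma noise_kernelC w x y : noise_kernel w x y = noise_kernel w y x.
Proof. by rewrite /noise_kernel adjC edC. Qed.

Lemma noise_trace_ge0 k w : 0 <= noise_trace k.*2 w.
Proof.
rewrite /noise_trace kernel_trace_double; last exact: noise_kernelC.
by apply: sumr_ge0 => x _; apply: sumr_ge0 => y _; exact: sqr_ge0.
Qed.

Lemma walk_prod_noise w x h : walk adj x h ->
  walk_prod (noise_kernel w) x h =
  \prod_(e in D) noise M p X O e w ^+ mult ed e x h.
Proof.
elim: h x => [|y h ih] x /=; first by rewrite big1.
case/andP => yx wy; rewrite ih// /noise_kernel yx.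
under [RHS]eq_bigr do rewrite exprD.
rewrite big_split/=; congr (_ * _).
rewrite (bigD1 (ed y x)) ?edD//= eqxx expr1 big1 ?mulr1// => e /andP[_].
by rewrite eq_sym => /negPf ->; rewrite expr0.
Qed.

Lemma mult_out e x h : walk adj x h -> e \notin D -> mult ed e x h = 0%N.
Proof.
move=> + eD; elim: h x => [|y h ih] x //= /andP[yx wy].
rewrite ih// addn0; apply/eqP; rewrite eqb0; apply: contraNneq eD => <-.
exact: edD.
Qed.

Lemma bm_noise_kernel x y : bounded_measurable (fun w => noise_kernel w x y).
Proof.
rewrite /noise_kernel; case: (adj x y); last exact: bm_cst.
exact: bm_noise.
Qed.

Lemma bm_walk_prod x h : bounded_measurable (fun w => walk_prod (noise_kernel w) x h).
Proof.
elim: h x => [|y h ih] x /=; first exact: bm_cst.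
by apply: bmM => //; exact: bm_noise_kernel.
Qed.

Lemma bm_walk_sum (G : V -> seq V -> T -> R) k x h :
  (forall y g, bounded_measurable (G y g)) ->
  bounded_measurable (fun w => walk_sum adj k (fun y g => G y g w) x h).
Proof.
move=> bG; elim: k x h => [|k ih] x h /=; first exact: bG.
by apply: bm_sum => y _; exact: ih.
Qed.

Lemma mean_walk_sum (G : V -> seq V -> T -> R) k x h :
  (forall y g, bounded_measurable (G y g)) ->
  mean P (fun w => walk_sum adj k (fun y g => G y g w) x h) =
  walk_sum adj k (fun y g => mean P (G y g)) x h.
Proof.
move=> bG; elim: k x h => [|k ih] x h //=.
rewrite mean_sum; last by move=> y _; exact: bm_walk_sum.
by apply: eq_bigr => y _; exact: ih.
Qed.

Let G (x y : V) (g : seq V) (w : T) : R :=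
  walk_prod (noise_kernel w) y g * (y == x)%:R.

Let bG x y g : bounded_measurable (G x y g).
Proof. by apply: bmM; [exact: bm_walk_prod|exact: bm_cst]. Qed.

Let noise_traceE k : noise_trace k =
  fun w => \sum_x walk_sum adj k (fun y g => G x y g w) x [::].
Proof.
apply/funext => w; apply: eq_bigr => x _.
rewrite walk_sum_kernel_pow; last first.
  by move=> y z /negPf yz; rewrite /noise_kernel yz.
rewrite mul1r (bigD1 x)//= eqxx mulr1 big1 ?addr0// => y /negPf ->.
by rewrite mulr0.
Qed.

Lemma bm_noise_trace k : bounded_measurable (noise_trace k).
Proof. by rewrite noise_traceE; apply: bm_sum => x _; exact: bm_walk_sum. Qed.

Lemma mean_noise_trace k (a : R) : 1 <= a -> a ^+ 4 = n%:R * p -> (0 < n)%N ->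
  mean P (noise_trace k) <= #|V|%:R * (2 * a ^+ 2 + 2 * a * k%:R) ^+ k.
Proof.
move=> a1 a4 n0.
(* No walk uses an edge outside [D]. The value [(m == 0)%:R] there meets the moment conditions and
   contributes the factor 1. *)
pose mu e m : R := if e \in D then mean P (fun w => noise M p X O e w ^+ m)
  else (m == 0)%:R.
have a4E : a ^+ 4 / n%:R = p by rewrite a4 mulrC mulKf// pnatr_eq0 -lt0n.
have /andP[p0 p1] := p01.
have mu0 e m : `|mu e m| <= 2 ^+ m.
  rewrite /mu; case: ifPn => _; first exact: mean_noiseX_le.
  by rewrite normr_nat; case: m => [|m]; rewrite ?expr0 ?exprn_ge0.
have mu1 e : mu e 1%N = 0.
  rewrite /mu; case: ifPn => // eD; exact: (mean_noise model p01 M1 eD).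
have mu2 e m : `|mu e m.+2| <= a ^+ 4 / n%:R * 2 ^+ m.
  rewrite a4E /mu; case: ifPn => [eD|_]; first exact: (mean_noiseX2_le model p01 M1 m eD).
  by rewrite normr0 mulr_ge0 ?exprn_ge0// ltW.
apply: le_trans (sum_prod_moments_le adjC edC ed_inj a1 n0 adj_le k mu0 mu1 mu2).
rewrite noise_traceE mean_sum; last by move=> x _; exact: bm_walk_sum.
apply: ler_sum => x _; rewrite mean_walk_sum//; apply: walk_sum_le => // y g wyg.
have -> : \prod_e mu e (mult ed e y g) = mean P (fun w => walk_prod (noise_kernel w) y g).
  have -> : (fun w => walk_prod (noise_kernel w) y g) =
      (fun w => \prod_(e in D) noise M p X O e w ^+ mult ed e y g).
    by apply/funext => w; exact: walk_prod_noise.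
  rewrite mean_prod_noise// [RHS]big_mkcond; apply: eq_bigr => e _.
  by rewrite /mu; case: ifPn => // eD; rewrite mult_out.
have -> : mean P (G x y g) = (y == x)%:R * mean P (fun w => walk_prod (noise_kernel w) y g).
  rewrite -meanZ; last exact: bm_walk_prod.
  by congr mean; apply/funext => w; rewrite /G mulrC.
(* The indicator of a closed walk is bounded by 1, as the count runs over all walks. *)
apply: le_trans (ler_norm _) _; rewrite normrM normr_nat ler_piMl//.
by rewrite lern1 leq_b1.
Qed.

End trace_moment.

(** * The noise matrix in the two models *)

Definition clipped_matrix (d : measure_display) (T : measurableType d)
    (R : realType) (P : probability T R) (n : nat)
    (X : 'I_n -> 'I_n -> {RV P >-> R}) (O : 'I_n -> 'I_n -> {RV P >-> bool})
    (w : T) : 'M[R]_n :=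
  \matrix_(i, j) if O i j w then truncate (X i j w) else 0.

(** The free entry of the symmetric model that stands for an unordered pair of vertices. *)
Definition sort_pair n (i j : 'I_n) : 'I_n * 'I_n := if (i <= j)%N then (i, j) else (j, i).

Lemma sort_pairC n (i j : 'I_n) : sort_pair i j = sort_pair j i.
Proof. by rewrite /sort_pair; case: ltngtP => // /val_inj ->. Qed.

Lemma sort_pair_inj n (i j i' j' : 'I_n) : sort_pair i j = sort_pair i' j' ->
  (i = i' /\ j = j') \/ (i = j' /\ j = i').
Proof.
rewrite /sort_pair; case: ifP => _; case: ifP => _ [-> ->]; by [left|right].
Qed.

Section both_models.
Context (d : measure_display) (T : measurableType d) (R : realType)
  (P : probability T R) (n : nat) (M : 'M[R]_n) (p : R)
  (X : 'I_n -> 'I_n -> {RV P >-> R}) (O : 'I_n -> 'I_n -> {RV P >-> bool})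
  (mk : model_kind).
Hypothesis model : data_model mk M p X O.
Hypothesis p01 : 0 < p <= 1.
Hypothesis M1 : forall i j, `|M i j| <= 1.
Hypothesis n0 : (0 < n)%N.

Lemma data_model_entries : entry_model (free_entries n mk) M p X O.
Proof. by case: mk model => //= -[]. Qed.

Lemma noise_clipped i j w :
  noise M p X O (i, j) w = (clipped_matrix X O w - p *: M) i j.
Proof.
rewrite /noise /observation_value !mxE /=.
by case: ifP => _; rewrite ?sub0r.
Qed.

(* An asymmetric matrix is turned into a symmetric kernel on 2n vertices. *)
Lemma trace_controls_norm (a : R) (q : nat) :
  1 <= a -> a ^+ 4 = n%:R * p -> (0 < q)%N ->
  exists tr : T -> R, [/\ bounded_measurable tr, forall w, 0 <= tr w,
    mean P tr <= 2 * n%:R * (2 * a ^+ 2 + 2 * a * q.*2%:R) ^+ q.*2 &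
    forall w lam, 0 <= lam -> tr w <= lam ^+ q.*2 ->
      op_bound lam (clipped_matrix X O w - p *: M)].
Proof.
move=> a1 a4 q0; have E := data_model_entries; have a0 : 0 <= a by apply: le_trans a1.
have B0 : 0 <= (2 * a ^+ 2 + 2 * a * q.*2%:R) ^+ q.*2.
  by rewrite exprn_ge0// addr_ge0// ?mulr_ge0 ?exprn_ge0.
case: mk model E => /= [_|[MT XT OT _]] E.
- pose adj (x y : 'I_n + 'I_n) : bool :=
    match x, y with inl _, inr _ => true | inr _, inl _ => true | _, _ => false end.
  (* Vertices of the same side are not adjacent; the value [sort_pair] there only makes [ed]
     symmetric. *)
  pose ed (x y : 'I_n + 'I_n) : 'I_n * 'I_n :=
    match x, y with inl i, inr j => (i, j) | inr j, inl i => (i, j)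
    | inl i, inl j => sort_pair i j | inr i, inr j => sort_pair i j end.
  have adjC : symmetric adj by case=> i [j|j].
  have edC x y : ed x y = ed y x by case: x y => i [j|j] //=; exact: sort_pairC.
  have ed_inj x y x' y' : adj x y -> adj x' y' ->
      ed x y = ed x' y' -> (x = x' /\ y = y') \/ (x = y' /\ y = x').
    by case: x y x' y' => i [j|j] [i'|i'] [j'|j'] //= _ _ [-> ->]; by [left|right].
  have edD x y : adj x y -> ed x y \in free_entries n Asymmetric by rewrite inE.
  have adj_le y : (#|[set x | adj y x]%SET| <= n)%N.
    case: y => i.
      have -> : [set x | adj (inl i) x]%SET = (inr @: setT)%SET.
        apply/setP => -[j|j]; rewrite !inE; last by rewrite imset_f ?inE.
        by symmetry; apply/imsetP => -[].
      by apply: leq_trans (leq_imset_card _ _) (leq_trans (max_card _) _); rewrite card_ord.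
    have -> : [set x | adj (inr i) x]%SET = (inl @: setT)%SET.
      apply/setP => -[j|j]; rewrite !inE; first by rewrite imset_f ?inE.
      by symmetry; apply/imsetP => -[].
    by apply: leq_trans (leq_imset_card _ _) (leq_trans (max_card _) _); rewrite card_ord.
  exists (noise_trace M p X O adj ed q.*2); split.
  + exact: bm_noise_trace.
  + by move=> w; apply: noise_trace_ge0.
  + apply: le_trans (mean_noise_trace E p01 M1 adjC edC ed_inj edD adj_le _ a1 a4 n0) _.
    by rewrite ler_wpM2r// card_sum card_ord natrD mulr2n mulrDl mul1r.
  + move=> w lam lam0 tr x y.
    (* The kernel sends a vector supported on the right vertices to one supported on the left
       vertices, and acts on it as the noise matrix acts on [y]. *)
    pose u (v : 'I_n + 'I_n) : R := match v with inl _ => 0 | inr j => y j 0 end.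
    have := kernel_contract u (noise_kernelC M p X O adjC edC w) q0 lam0 tr.
    rewrite !big_sumType /= [X in _ + X]big1 ?addr0 => [|j _]; last first.
      rewrite /kernel_mul big1 ?expr0n// => -[i|i] _; rewrite ?mulr0//.
      by rewrite /noise_kernel mul0r.
    rewrite [X in _ <= _ * (X + _)]big1 ?add0r => [Hu|i _]; last by rewrite expr0n.
    have -> : dot x ((clipped_matrix X O w - p *: M) *m y) =
        \sum_i x i 0 * kernel_mul (noise_kernel M p X O adj ed w) u (inl i).
      rewrite dotE; apply: eq_bigr => i _; congr (_ * _).
      rewrite [LHS]mxE /kernel_mul big_sumType/= [X in _ = X + _]big1 ?add0r => [|j _].
        by apply: eq_bigr => j _; rewrite /noise_kernel/= noise_clipped.
      by rewrite mulr0.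
    apply: le_trans (cauchy_schwarz_sum _ _ _) _; rewrite mulrCA !dotE.
    have sq (z : 'cV[R]_n) : \sum_i z i 0 ^+ 2 = \sum_i z i 0 * z i 0.
      by apply: eq_bigr => i _; rewrite expr2.
    rewrite -!sq ler_wpM2l//; first by apply: sumr_ge0 => i _; exact: sqr_ge0.
- pose adj (x y : 'I_n) := true.
  have adjC : symmetric adj by [].
  have edD (x y : 'I_n) : adj x y -> sort_pair x y \in free_entries n Symmetric.
    by move=> _; rewrite inE /sort_pair; case: (leqP x y) => xy //=; exact: ltnW.
  have adj_le y : (#|[set x | adj y x]%SET| <= n)%N.
    by rewrite -[leqRHS]card_ord max_card.
  have ed_inj x y x' y' : adj x y -> adj x' y' -> sort_pair x y = sort_pair x' y' ->
      (x = x' /\ y = y') \/ (x = y' /\ y = x').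
    by move=> _ _; exact: sort_pair_inj.
  exists (noise_trace M p X O adj (@sort_pair n) q.*2); split.
  + exact: bm_noise_trace.
  + by move=> w; apply: noise_trace_ge0 => //; exact: sort_pairC.
  + apply: le_trans (mean_noise_trace E p01 M1 adjC (@sort_pairC n) ed_inj edD adj_le _ a1 a4 n0) _.
    by rewrite ler_wpM2r// card_ord ler_peMl// ler1n.
  + move=> w lam lam0 tr x y.
    have := kernel_contract (fun j => y j 0)
      (noise_kernelC M p X O adjC (@sort_pairC n) w) q0 lam0 tr.
    move=> Hu.
    have -> : dot x ((clipped_matrix X O w - p *: M) *m y) =
        \sum_i x i 0 * kernel_mul (noise_kernel M p X O adj (@sort_pair n) w)
           (fun j => y j 0) i.
      rewrite dotE; apply: eq_bigr => i _; congr (_ * _).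
      rewrite [LHS]mxE /kernel_mul; apply: eq_bigr => j _; congr (_ * _).
      rewrite /noise_kernel/= /sort_pair; case: ifP => _; rewrite noise_clipped//.
      by rewrite !mxE XT OT -[in LHS]MT mxE.
    apply: le_trans (cauchy_schwarz_sum _ _ _) _; rewrite mulrCA !dotE.
    have sq (z : 'cV[R]_n) : \sum_i z i 0 ^+ 2 = \sum_i z i 0 * z i 0.
      by apply: eq_bigr => i _; rewrite expr2.
    rewrite -!sq ler_wpM2l//; first by apply: sumr_ge0 => i _; exact: sqr_ge0.
Qed.

Lemma clipped_observed : exists A : set T, [/\ measurable A, P A = 0%E &
  forall w, ~ A w -> clipped_matrix X O w = observed_matrix X O w].
Proof.
have [A [mA PA HA]] := entry_bounded_null data_model_entries.
exists A; split => // w Aw; apply/matrixP => i j; rewrite !mxE.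
case: ifP => // _; rewrite truncate_id//.
case: mk model HA => /= [_ HA|[_ XT _ _] HA]; first by apply: HA; rewrite ?inE.
have [ij|ji] := leqP i j; first by apply: HA; rewrite ?inE.
by rewrite XT; apply: HA; rewrite ?inE//= ltnW.
Qed.

(** The upper triangle and its transpose cover the square. *)
Lemma card_free_entries : (n ^ 2 <= 2 * #|free_entries n mk|)%N.
Proof.
have ordE : (n ^ 2 = #|[set: 'I_n * 'I_n]%SET|)%N.
  by rewrite cardsT card_prod card_ord expnS expn1.
case: mk => /=; first by rewrite ordE leq_pmull.
set S := [set ij : 'I_n * 'I_n | (ij.1 <= ij.2)%N]%SET.
pose sw (ij : 'I_n * 'I_n) := (ij.2, ij.1).
have swK : involutive sw by case.
rewrite ordE mul2n -addnn -[X in (_ <= _ + X)%N](card_imset _ (inv_inj swK)).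
have <- : (S :|: sw @: S)%SET = [set: 'I_n * 'I_n]%SET.
  apply/setP => -[i j]; rewrite !inE /=; have [//|ji] := leqP i j.
  apply/imsetP; exists (j, i) => //; by rewrite inE /= ltnW.
by rewrite cardsU leq_subr.
Qed.

Lemma observed_proportion_dev w : observed_proportion mk O w - p =
  #|free_entries n mk|%:R^-1 * \sum_(e in free_entries n mk) obs_dev p X O e w.
Proof.
have D0 : (0 < #|free_entries n mk|)%N.
  by have := card_free_entries; case: #|_| => //; rewrite muln0 leqNgt expn_gt0 n0.
rewrite /observed_proportion.
have -> : \sum_(e in free_entries n mk) obs_dev p X O e w =
  \sum_(e in free_entries n mk) ((O e.1 e.2 w)%:R - p).
  apply: eq_bigr => e _; rewrite /obs_dev /observation_value.
  by case: (O _ _ w); rewrite ?sub0r.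
rewrite sumrB sumr_const -natr_sum -[p *+ _]mulr_natr.
have -> : (\sum_(e in free_entries n mk) O e.1 e.2 w)%N =
    #|[set ij in free_entries n mk | O ij.1 ij.2 w]%SET|.
  rewrite -sum1_card big_mkcond [RHS]big_mkcond; apply: eq_bigr => e _.
  by rewrite inE; case: (e \in _) => //=; case: (O _ _ w).
by field; rewrite pnatr_eq0 -lt0n.
Qed.

Lemma mean_observed_proportion_dev :
  bounded_measurable (fun w => (observed_proportion mk O w - p) ^+ 2) /\
  mean P (fun w => (observed_proportion mk O w - p) ^+ 2) <= 2 * p / n%:R ^+ 2.
Proof.
have D0 : (0 < #|free_entries n mk|)%N.
  by have := card_free_entries; case: #|_| => //; rewrite muln0 leqNgt expn_gt0 n0.
have /andP[p0 p1] := p01.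
have -> : (fun w => (observed_proportion mk O w - p) ^+ 2) = fun w =>
  (#|free_entries n mk|%:R^-1 * \sum_(e in free_entries n mk) obs_dev p X O e w) ^+ 2.
  by apply/funext => w; rewrite observed_proportion_dev.
split.
  by apply: bmX; apply: bmZ; apply: bm_sum => e _; exact: bm_obs_dev.
apply: le_trans (mean_obs_dev_sum data_model_entries p01 D0) _.
rewrite ler_pdivrMr ?ltr0n// mulrAC ler_pdivlMr ?exprn_gt0 ?ltr0n//.
rewrite [2 * p]mulrC -mulrA ler_wpM2l ?(ltW p0)//.
by rewrite -natrX -natrM ler_nat card_free_entries.
Qed.

End both_models.

(** * Grids and powers *)

(* The integral of a nonnegative function, measurable or not, is a supremum over
   the simple functions below it. *)
Lemma integral_le_mean (d : measure_display) (T : measurableType d) (R : realType)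
    (P : probability T R) (f g : T -> R) : bounded_measurable g ->
  (forall w, 0 <= f w) -> (forall w, f w <= g w) ->
  ('E_P[f] <= (mean P g)%:E)%E.
Proof.
move=> bg f0 fg; rewrite unlock.
have -> : (mean P g)%:E = (\int[P]_w (g w)%:E)%E.
  rewrite /mean /Rintegral fineK//.
  exact: integrable_fin_num (bm_integrable P bg).
rewrite !ge0_integralTE; last 2 first.
- by move=> w; rewrite lee_fin (le_trans (f0 w)).
- by move=> w; rewrite lee_fin.
apply: ge_ereal_sup => _ [h hf <-]; apply: ereal_sup_ubound; exists h => //= w.
by apply: le_trans (hf w) _; rewrite lee_fin.
Qed.

(** Each of the [q.+1] terms of 1 + y + ... + y^q is at least y^q, and the sum is below 1 / (1 -
    y). *)
Lemma linear_geometric_bounded (R : realFieldType) (y : R) : 0 < y < 1 ->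
  exists2 C, 0 <= C & forall q : nat, q.+1%:R * y ^+ q <= C.
Proof.
move=> /andP[y0 y1]; pose b := 1 / (1 - y).
have y10 : 0 < 1 - y by rewrite subr_gt0.
exists b => [|q]; first by rewrite divr_ge0// ltW.
rewrite /b ler_pdivlMr//.
have : q.+1%:R * y ^+ q * (1 - y) <= 1 - y ^+ q.+1.
  elim: q => [|q ih]; first by rewrite expr0 !mul1r expr1.
  have := ler_wpM2l (ltW y0) ih; have := exprn_ge0 q (ltW y0).
  have : y ^+ q.+1 <= 1 by rewrite exprn_ile1// ltW.
  rewrite -[q.+2%:R]natr1 !exprS; move: (y ^+ q) (q.+1%:R : R) => z m.
  by move=> h1 z0 h2; nra.
by move=> h; apply: (le_trans h); rewrite gerBl exprn_ge0// ltW.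
Qed.

(** With x = y^2, one factor [y ^+ q] absorbs a power of [q.+1] and the other is left to the
    induction. *)
Lemma poly_geometric_bounded (R : rcfType) (j : nat) (x : R) : 0 < x < 1 ->
  exists2 C, 0 <= C & forall q : nat, q.+1%:R ^+ j * x ^+ q <= C.
Proof.
elim: j x => [|j ih] x /andP[x0 x1].
  by exists 1 => // q; rewrite expr0 mul1r exprn_ile1// ltW.
pose y := Num.sqrt x.
have y01 : 0 < y < 1.
  by rewrite sqrtr_gt0 x0/= -[ltRHS]sqrtr1 ltr_sqrt.
have yE : x = y ^+ 2 by rewrite sqr_sqrtr// ltW.
have [C C0 HC] := ih y y01; have [C' C'0 HC'] := linear_geometric_bounded y01.
exists (C * C') => [|q]; first exact: mulr_ge0.
have /andP[y0 _] := y01.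
have -> : q.+1%:R ^+ j.+1 * x ^+ q = (q.+1%:R ^+ j * y ^+ q) * (q.+1%:R * y ^+ q).
  by rewrite yE exprAC expr2 exprS; ring.
by apply: ler_pM; rewrite ?mulr_ge0 ?exprn_ge0// ltW.
Qed.

Section grid.
Variables (R : realType) (k : nat) (B : R) (D : nat).
Hypotheses (B0 : 0 < B) (D0 : (0 < D)%N).

(** A coordinate equal to [B] gets the index [D], hence [D.+1] cells per axis. *)
Definition grid_cell (x : 'rV[R]_k) : {ffun 'I_k -> 'I_D.+1} :=
  [ffun i => inord (Num.truncn ((x 0 i + B) * D%:R / (2 * B)))].

Lemma grid_cell_close (x y : 'rV[R]_k) : (forall i, `|x 0 i| <= B) -> (forall i, `|y 0 i| <= B) ->
  grid_cell x = grid_cell y ->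
  enorm (x - y) <= Num.sqrt k%:R * (2 * B / D%:R).
Proof.
move=> xB yB xy.
have DR : (0 : R) < D%:R by rewrite ltr0n.
have h0 : 0 <= 2 * B / D%:R by rewrite divr_ge0 ?mulr_ge0 ?(ltW B0).
have B20 : 0 < 2 * B by rewrite mulr_gt0.
pose z (x : 'rV[R]_k) i := (x 0 i + B) * D%:R / (2 * B).
have zb (u : 'rV[R]_k) i : `|u 0 i| <= B -> 0 <= z u i <= D%:R.
  rewrite ler_norml => /andP[u1 u2]; apply/andP; split.
    by rewrite divr_ge0 ?(ltW B20)// mulr_ge0//; lra.
  rewrite ler_pdivrMr// mulrC ler_wpM2l//; lra.
have close i : `|(x - y) 0 i| <= 2 * B / D%:R.
  have := congr1 (fun g : {ffun 'I_k -> 'I_D.+1} => val (g i)) xy; rewrite !ffunE.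
  have /andP[zx0 zxD] := zb x i (xB i); have /andP[zy0 zyD] := zb y i (yB i).
  have lt u : z u i <= D%:R -> (Num.truncn (z u i) < D.+1)%N.
    move=> uD; rewrite ltnS truncn_le_nat; apply: le_lt_trans uD _.
    by rewrite ltr_nat.
  rewrite /= !inordK ?lt//= -!/(z _ i) => E.
  have /andP[x1 x2] := truncn_itv zx0; have /andP[y1 y2] := truncn_itv zy0.
  move: x1 x2; rewrite -!/(z _ i) E => x1 x2.
  have zxy : `|z x i - z y i| <= 1.
    by move: x1 x2 y1 y2; rewrite -!natr1 ler_norml => *; apply/andP; split; lra.
  have -> : (x - y) 0 i = (z x i - z y i) * (2 * B / D%:R).
    by rewrite /z !mxE; field; rewrite !gt_eqF.
  by rewrite normrM [`|2 * B / _|]ger0_norm// ler_piMl.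
rewrite /enorm -[X in _ * X]ger0_norm// -sqrtr_sqr -sqrtrM// ler_wsqrtr//.
rewrite mulr_natl -[X in _ *+ X]card_ord -sumr_const; apply: ler_sum => i _.
by rewrite -[leLHS]real_normK ?num_real// ler_sqr ?nnegrE.
Qed.

End grid.

Lemma bounded_set_entries (R : realType) (k : nat) (K : set 'rV[R]_k) :
  bounded_set K -> exists2 B : R, 0 < B & forall x, K x -> forall i, `|x 0 i| <= B.
Proof.
move=> [B [_ KB]]; exists (`|B| + 1); first by rewrite ltr_wpDl.
move=> x Kx i; have := KB (`|B| + 1) _ x Kx.
rewrite (le_lt_trans (ler_norm B)) ?ltrDl// => /(_ isT) xB.
apply: le_trans xB; rewrite -[leRHS]/(mx_norm x) mx_normrE.
by apply: (le_bigmax _ _ (0, i)).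
Qed.

(** Replaces the real exponent of the rate by a root [t] of [n], so that only integer powers
    remain. *)
Lemma powR_root_bounds (R : realType) (n k : nat) : (0 < n)%N ->
  exists t : R, [/\ 1 <= t, t ^+ (k + 2) = n%:R &
    n%:R `^ (- (k%:R + 2)^-1) = t^-1].
Proof.
move=> n0; pose t : R := n%:R `^ (k%:R + 2)^-1.
have k2 : k%:R + 2 = (k + 2)%:R :> R by rewrite natrD.
have t0 : 0 < t by apply: powR_gt0; rewrite ltr0n.
have tn : t ^+ (k + 2) = n%:R.
  rewrite -powR_mulrn ?(ltW t0)// /t k2 -powRrM mulVf ?powRr1 ?ler0n//.
exists t; split => //; last by rewrite powRN.
rewrite leNgt; apply/negP => t1.
have : t ^+ (k + 2) < 1 by rewrite exprn_ilt1 ?(ltW t0)// addn2.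
by rewrite tn ltNge ler1n n0.
Qed.

(** The left side is Markov's bound for the probability of a large noise norm. It is at most 2n x^q
    with x = y^2 < 1, and n^2 <= a^24 together with a <= (q+1) 32 / eta reduces the claim to the
    boundedness of (q+1)^24 x^q. The exponent 24 comes from n <= (np)^3 = a^12. *)
Lemma trace_ratio_bound (R : realType) (eta : R) : 0 < eta < 1 ->
  exists2 C1 : R, 0 <= C1 & forall (a : R) (n q : nat), 0 < a -> (0 < n)%N ->
    n%:R ^+ 2 <= a ^+ 24 -> q%:R <= a * eta / 32 -> a * eta / 32 <= q.+1%:R ->
    2 * n%:R * (2 * a ^+ 2 + 2 * a * q.*2%:R) ^+ q.*2
      / ((2 + eta / 4) * a ^+ 2) ^+ q.*2 <= C1 / n%:R.
Proof.
move=> /andP[eta0 eta1].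
pose y := (1 + eta / 16) / (1 + eta / 8); pose x := y ^+ 2.
have e8 : 0 < 1 + eta / 8 by lra.
have e16 : 0 < 1 + eta / 16 by lra.
have y0 : 0 < y by rewrite divr_gt0.
have y1 : y < 1 by rewrite ltr_pdivrMr//; lra.
have x01 : 0 < x < 1 by rewrite exprn_gt0//= exprn_ilt1// ltW.
have [C0 C00 HC] := poly_geometric_bounded 24 x01.
have s0 : 0 < 32 / eta by rewrite divr_gt0.
exists (2 * C0 * (32 / eta) ^+ 24) => [|a n q a0 n0 na qa aq].
  by apply: mulr_ge0; [exact: mulr_ge0|rewrite exprn_ge0// ltW].
have nR : (0 : R) < n%:R by rewrite ltr0n.
have a20 : 0 < a ^+ 2 by rewrite exprn_gt0.
have lam0 : 0 < (2 + eta / 4) * a ^+ 2 by rewrite mulr_gt0//; lra.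
rewrite -mulrA -expr_div_n.
have ratio : (2 * a ^+ 2 + 2 * a * q.*2%:R) / ((2 + eta / 4) * a ^+ 2) <= y.
  rewrite ler_pdivrMr// /y.
  have -> : (1 + eta / 16) / (1 + eta / 8) * ((2 + eta / 4) * a ^+ 2) =
      (2 + eta / 8) * a ^+ 2.
    by field; rewrite gt_eqF//; lra.
  rewrite -mul2n natrM; have := ler_wpM2l (ltW a0) qa; nra.
have xq : ((2 * a ^+ 2 + 2 * a * q.*2%:R) / ((2 + eta / 4) * a ^+ 2)) ^+ q.*2 <= x ^+ q.
  rewrite /x -exprM mul2n lerXn2r ?nnegrE ?(ltW y0)// divr_ge0 ?(ltW lam0)//.
  by rewrite addr_ge0// !mulr_ge0 ?(ltW a20) ?(ltW a0).
have x0 : 0 <= x ^+ q by rewrite exprn_ge0//; case/andP: x01 => /ltW.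
have a24 : a ^+ 24 * x ^+ q <= C0 * (32 / eta) ^+ 24.
  have as0 : 0 <= a * eta / 32 by rewrite divr_ge0// mulr_ge0// ltW.
  apply: (@le_trans _ _ ((q.+1%:R ^+ 24 * x ^+ q) * (32 / eta) ^+ 24)); last first.
    by rewrite ler_wpM2r// exprn_ge0// ltW.
  rewrite [leRHS]mulrAC ler_wpM2r// -exprMn lerXn2r ?nnegrE ?(ltW a0) ?(mulr_ge0 _ (ltW s0))//.
  have -> : a = a * eta / 32 * (32 / eta) by field; rewrite gt_eqF.
  by rewrite ler_wpM2r// ltW.
rewrite ler_pdivlMr//; apply: (@le_trans _ _ (2 * (n%:R ^+ 2 * x ^+ q))).
  apply: (@le_trans _ _ (2 * n%:R * x ^+ q * n%:R)).
    by rewrite ler_wpM2r ?(ltW nR)// ler_wpM2l// mulr_ge0// ltW.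
  by rewrite le_eqVlt; apply/orP; left; apply/eqP; ring.
rewrite -[leRHS]mulrA ler_wpM2l//; apply: le_trans a24.
by rewrite ler_wpM2r.
Qed.

Lemma block_approximation (R : realType) (k n : nat) (K : set 'rV[R]_k) (B L t : R)
    (f : 'rV[R]_k -> 'rV[R]_k -> R) (beta : 'I_n -> 'rV[R]_k) :
  0 < B -> (forall x, K x -> forall i, `|x 0 i| <= B) -> 0 <= L ->
  1 <= t -> t ^+ (k + 2) = n%:R ->
  (forall x y, K x -> K y -> `|f x y| <= 1) ->
  (forall x y x' y', K x -> K y -> K x' -> K y' ->
     `|f x y - f x' y'| <= L * enorm (x - x') + L * enorm (y - y')) ->
  (forall i, K (beta i)) ->
  exists (C : finType) (c : 'I_n -> C) (g : C -> 'I_n -> R),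
  [/\ forall a j, `|g a j| <= 1,
      forall i j, `|f (beta i) (beta j) - g (c i) j| <= L * (Num.sqrt k%:R * (2 * B)) * t^-1 &
      Num.sqrt #|C|%:R <= Num.sqrt (3 ^+ k) * (Num.sqrt n%:R * t^-1)].
Proof.
move=> B0 KB L0 t1 tn f1 fL Kb.
have t0 : 0 < t by apply: lt_le_trans t1.
(* Then t < D <= t + 1, so the [D.+1] cells per axis are at most t + 2 <= 3t: this is the source of
   [3 ^+ k]. *)
pose D := (Num.truncn t).+1.
have D0 : (0 < D)%N by [].
have /andP[Dt tD] := truncn_itv (ltW t0).
pose c i := grid_cell B D (beta i).
(* The row of some point of the cell represents the cell; an empty cell gets 0, which respects the
   bound on [g]. *)
pose g a j : R := if [pick i | c i == a] is Some i then f (beta i) (beta j) else 0.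
exists {ffun 'I_k -> 'I_D.+1}, c, g; split.
- move=> a j; rewrite /g; case: pickP => [i _|_]; last by rewrite normr0.
  exact: f1.
- move=> i j; rewrite /g; case: pickP => [i' /eqP ci|/(_ i)]; last by rewrite eqxx.
  apply: (le_trans (fL _ _ _ _ (Kb _) (Kb _) (Kb _) (Kb _))).
  have -> : enorm (beta j - beta j) = 0.
    rewrite /enorm big1 ?sqrtr0// => l _.
    by rewrite !mxE subrr expr0n.
  rewrite mulr0 addr0 -mulrA ler_wpM2l//.
  apply: (le_trans (grid_cell_close B0 D0 (KB _ (Kb i)) (KB _ (Kb i')) _)).
    by rewrite -/(c i) -/(c i') ci.
  rewrite -[leRHS]mulrA ler_wpM2l ?sqrtr_ge0// ler_wpM2l ?mulr_ge0 ?(ltW B0)//.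
  by rewrite lef_pV2 ?posrE ?ltr0n// ltW.
- rewrite card_ffun !card_ord.
  have -> : Num.sqrt (3 ^+ k) * (Num.sqrt n%:R * t^-1) = Num.sqrt ((3 * t) ^+ k) :> R.
    rewrite -[t^-1]ger0_norm ?invr_ge0 ?(ltW t0)// -sqrtr_sqr.
    rewrite -sqrtrM ?ler0n// -sqrtrM ?exprn_ge0//; congr Num.sqrt.
    by rewrite -tn exprMn exprD; field; rewrite gt_eqF.
  rewrite ler_wsqrtr// natrX lerXn2r ?nnegrE ?mulr_ge0 ?(ltW t0)//.
  move: Dt tD; rewrite /D -!natr1 => Dt tD; lra.
Qed.

(** * Choice of the constants and assembly of the estimates *)

Theorem theorem2p7 (R : realType) (eta : R) (heta : 0 < eta < 1)
    (k : nat) (hk : (1 <= k)%N) (K : set 'rV[R]_k)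
    (Kbounded : bounded_set K) (Kclosed : closed K) (L : R) (hL : 0 <= L) :
  exists C : R,
    forall (f : 'rV[R]_k -> 'rV[R]_k -> R)
      (f_bounded : forall x y, K x -> K y -> -1 <= f x y <= 1)
      (f_lipschitz : forall x y x' y', K x -> K y -> K x' -> K y' ->
         `|f x y - f x' y'| <= L * enorm (x - x') + L * enorm (y - y'))
      (n : nat) (hn : (1 <= n)%N)
      (beta : 'I_n -> 'rV[R]_k) (hbeta : forall i, K (beta i))
      (p : R) (hp : 0 < p <= 1)
      (d : measure_display) (T : measurableType d) (P : probability T R)
      (X : 'I_n -> 'I_n -> {RV P >-> R})
      (O : 'I_n -> 'I_n -> {RV P >-> bool})
      (mk : model_kind)
      (M : 'M[R]_n) (hM : M = \matrix_(i, j) f (beta i) (beta j))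
      (hmodel : data_model mk M p X O)
      (Mhat : T -> 'M[R]_n)
      (hMhat : forall w, is_usvt eta (observed_proportion mk O w)
                           (observed_matrix X O w) (Mhat w)),
      (MSE P Mhat M
         <= (C * (n%:R `^ (- (k%:R + 2)^-1) / Num.sqrt p))%:E)%E.
Proof.
have [B B0 KB] := bounded_set_entries Kbounded.
have [C1 C10 HC1] := trace_ratio_bound heta.
pose c1 : R := Num.sqrt (3 ^+ k); pose c2 : R := L * (Num.sqrt k%:R * (2 * B)).
have /andP[eta0 eta1] := heta.
have c10 : 0 <= c1 by exact: sqrtr_ge0.
have c20 : 0 <= c2 by rewrite !mulr_ge0 ?sqrtr_ge0 ?(ltW B0).
have h32 : 0 < 32 / eta by rewrite divr_gt0.
pose C2 : R := 4 * ((36 / eta + 9) * (c1 + c2)).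
have C20 : 0 <= C2.
  by rewrite /C2 !mulr_ge0 ?addr_ge0// divr_ge0// ltW.
(* The first term pays, by Chebyshev, for [phat] off by more than [eta / 6 * p]; the 4 is the
   coefficient of the squared deviation in [usvt_error]. *)
pose C3 : R := 4 / (eta / 6) ^+ 2 + 4.
have C30 : 0 <= C3 by rewrite addr_ge0// divr_ge0// sqr_ge0.
(* The two terms cover the cases left to the trivial bound 4: a rate of at least 1, and [n] at most
   [(32 / eta) ^+ 12]. *)
pose C4 : R := 4 + 4 * (32 / eta) ^+ 12.
have C40 : 0 <= 4 * (32 / eta) ^+ 12 by rewrite mulr_ge0// exprn_ge0// ltW.
exists (4 * C1 + C3 * 2 + C2 + C4).
move=> f f_bounded f_lipschitz n hn beta hbeta p hp d T P X O mk M hM hmodel Mhat hMhat.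
have [t [t1 tn ->]] := powR_root_bounds R k hn.
have t0 : 0 < t by apply: lt_le_trans t1.
have /andP[p0 p1] := hp.
have rp0 : 0 < Num.sqrt p by rewrite sqrtr_gt0.
have rp1 : Num.sqrt p <= 1 by rewrite -sqrtr1 ler_wsqrtr.
have nR : (0 : R) < n%:R by rewrite ltr0n.
set rate := t^-1 / Num.sqrt p.
have rate0 : 0 < rate by rewrite divr_gt0// invr_gt0.
have t_rate : t^-1 <= rate.
  by rewrite /rate ler_pdivlMr// ler_piMr// invr_ge0 ltW.
have n_rate : n%:R^-1 <= rate.
  apply: le_trans t_rate; rewrite lef_pV2 ?posrE// -tn.
  by rewrite ler_eXnr// addn2.
have f1 x y : K x -> K y -> `|f x y| <= 1.
  by move=> Kx Ky; rewrite ler_norml f_bounded.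
have M1 i j : `|M i j| <= 1 by rewrite hM mxE f1.
pose SE w := (n%:R ^+ 2)^-1 * \sum_(i < n) \sum_(j < n) (Mhat w i j - M i j) ^+ 2.
have SE0 w : 0 <= SE w.
  rewrite mulr_ge0 ?invr_ge0 ?exprn_ge0// sumr_ge0// => i _.
  by rewrite sumr_ge0// => j _; exact: sqr_ge0.
have SE4 w : SE w <= 4.
  rewrite /SE ler_pdivrMl ?exprn_gt0//.
  have -> : n%:R ^+ 2 * 4 = \sum_(i < n) \sum_(j < n) 4 :> R.
    by rewrite !sumr_const card_ord -mulrnA -[RHS]mulr_natl natrM expr2.
  apply: ler_sum => i _; apply: ler_sum => j _.
  have [U [s [V [_ ->]]]] := hMhat w; rewrite mxE.
  have := truncate_norm (usvt_W eta (observed_proportion mk O w) U s V i j).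
  have := M1 i j; rewrite !ler_norml; move: (truncate _) (M i j) => z m.
  by move=> /andP[m1 m2] /andP[z1 z2]; nra.
have trivial_case : 4 <= C4 * rate ->
    (MSE P Mhat M <= ((4 * C1 + C3 * 2 + C2 + C4) * rate)%:E)%E.
  move=> h4; have := integral_le_mean P (bm_cst T 4) SE0 SE4.
  rewrite mean_cst => h; apply: (le_trans h); rewrite lee_fin mulrDl; apply: le_trans h4 _.
  by rewrite lerDr mulr_ge0 ?(ltW rate0)// !addr_ge0// mulr_ge0.
have [rate1|rate1] := leP 1 rate.
  apply: trivial_case; rewrite /C4 mulrDl -[leLHS]addr0; apply: lerD.
    by rewrite ler_peMr.
  by rewrite mulr_ge0// ltW.
(* Here k >= 1 enters: t^3 <= n, so t sqrt p >= 1 forces n p >= n^(1/3). *)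
have np3 : 1 <= n%:R ^+ 2 * p ^+ 3.
  have tp : 1 <= t * Num.sqrt p.
    by move: rate1; rewrite /rate ltr_pdivrMr// mul1r -[_^-1]mul1r ltr_pdivrMr// mulrC => /ltW.
  have tp6 : 1 <= (t * Num.sqrt p) ^+ 6 by rewrite exprn_ege1.
  apply: (le_trans tp6); rewrite exprMn.
  have -> : Num.sqrt p ^+ 6 = p ^+ 3.
    by rewrite -[p in RHS](sqr_sqrtr (ltW p0)) -exprM.
  rewrite ler_wpM2r ?exprn_ge0 ?(ltW p0)// -tn -exprM ler_weXn2l//.
  by rewrite -[6%N]/(3 * 2)%N leq_pmul2r// addn2.
have np3' : n%:R <= (n%:R * p) ^+ 3.
  rewrite exprMn exprS -mulrA ler_peMr// ltW//.
have np1 : 1 <= n%:R * p.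
  rewrite leNgt; apply/negP => np.
  have : (n%:R * p) ^+ 3 < 1 by rewrite exprn_ilt1// mulr_ge0// ltW.
  by apply/negP; rewrite -leNgt (le_trans _ np3')// ler1n.
pose th := Num.sqrt (n%:R * p); pose a := Num.sqrt th.
have th1 : 1 <= th by rewrite -sqrtr1 ler_wsqrtr.
have a1 : 1 <= a by rewrite -sqrtr1 ler_wsqrtr.
have a0 : 0 < a by apply: lt_le_trans a1.
have a2 : a ^+ 2 = th by rewrite sqr_sqrtr// (le_trans _ th1).
have a4 : a ^+ 4 = n%:R * p.
  by rewrite -[4%N]/(2 * 2)%N exprM a2 sqr_sqrtr// (le_trans _ np1).
have a12 : n%:R <= a ^+ 12 by rewrite -[12%N]/(4 * 3)%N exprM a4.
have a24 : n%:R ^+ 2 <= a ^+ 24.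
  by rewrite -[24%N]/(12 * 2)%N exprM lerXn2r ?nnegrE ?exprn_ge0 ?(ltW a0).
pose q := Num.truncn (a * eta / 32).
have ae0 : 0 <= a * eta / 32 by rewrite divr_ge0// mulr_ge0// ltW.
have /andP[qa aq] := truncn_itv ae0.
(* If [q] is 0 then a < 32 / eta, and n <= a^12 is bounded in terms of [eta]. *)
have [q0|q0] := posnP q.
  apply: trivial_case; rewrite /C4 mulrDl -[leLHS]add0r; apply: lerD.
    by rewrite mulr_ge0// ltW.
  rewrite -mulrA ler_peMr//; move: aq; rewrite -/q q0 => aq.
  have a32 : a <= 32 / eta by rewrite ler_pdivlMr//; lra.
  apply: (@le_trans _ _ (n%:R * n%:R^-1)); first by rewrite divff// gt_eqF.
  apply: ler_pM => //; apply: le_trans a12 _.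
  by rewrite lerXn2r ?nnegrE ?(ltW a0) ?(ltW h32).
have [tr [btr tr0 trm trop]] := trace_controls_norm hmodel hp M1 hn a1 a4 q0.
have [A [mA PA HA]] := clipped_observed hmodel.
have [bdev mdev] := mean_observed_proportion_dev hmodel hp hn.
set dev := (fun w => _) in bdev mdev.
pose lam := (2 + eta / 4) * a ^+ 2.
have lam0 : 0 < lam by rewrite mulr_gt0 ?exprn_gt0//; lra.
have [Cl [c [g [g1 Mg Cc]]]] := block_approximation B0 KB hL t1 tn f1 f_lipschitz hbeta.
have pp0 : 0 < p ^+ 2 by rewrite exprn_gt0.
(* Each of the first three terms is at least 4 on its exceptional event: unbounded entries, large
   trace, [phat] far from [p]. Off these events the last two terms dominate the error. *)
pose G w := 4 * \1_A w + 4 / lam ^+ q.*2 * tr w + C3 / p ^+ 2 * dev w + C2 * rate.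
have b1 : bounded_measurable (fun w => 4 * (\1_A w : R)) by apply: bmZ; exact: bm_indic.
have b2 : bounded_measurable (fun w => 4 / lam ^+ q.*2 * tr w) by exact: bmZ.
have b3 : bounded_measurable (fun w => C3 / p ^+ 2 * dev w) by exact: bmZ.
have bG : bounded_measurable G.
  by apply: bmD; [apply: bmD => //; exact: bmD|exact: bm_cst].
have dev0 w : 0 <= dev w by exact: sqr_ge0.
have p10 w : 0 <= 4 * (\1_A w : R) by rewrite mulr_ge0// indicE ler0n.
have p20 w : 0 <= 4 / lam ^+ q.*2 * tr w.
  by rewrite mulr_ge0// divr_ge0// exprn_ge0// ltW.
have p30 w : 0 <= C3 / p ^+ 2 * dev w by rewrite mulr_ge0// divr_ge0// ltW.
have p40 : 0 <= C2 * rate by rewrite mulr_ge0// ltW.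
have SEG w : SE w <= G w.
  have := p10 w; have := p20 w; have := p30 w => h3 h2 h1.
  have [Aw|Aw] := pselect (A w).
    apply: (le_trans (SE4 w)); rewrite /G indicE mem_set// mulr1; lra.
  have [trl|trl] := leP (tr w) (lam ^+ q.*2); last first.
    apply: (le_trans (SE4 w)).
    suff : 4 <= 4 / lam ^+ q.*2 * tr w by rewrite /G; lra.
    rewrite -mulrA ler_peMr// mulrC ler_pdivlMr ?exprn_gt0// mul1r; exact: ltW.
  have [devl|devl] := leP (dev w) ((eta / 6 * p) ^+ 2); last first.
    apply: (le_trans (SE4 w)).
    suff : 4 <= C3 / p ^+ 2 * dev w by rewrite /G; lra.
    apply: (@le_trans _ _ (4 / (eta / 6) ^+ 2 / p ^+ 2 * (eta / 6 * p) ^+ 2)).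
      by rewrite le_eqVlt; apply/orP; left; apply/eqP; field; rewrite !gt_eqF.
    apply: ler_pM; rewrite ?sqr_ge0 ?divr_ge0 ?sqr_ge0 ?(ltW devl)//.
    by rewrite ler_wpM2r ?invr_ge0 ?(ltW pp0)// lerDl.
  have ph : `|observed_proportion mk O w - p| <= eta / 6 * p.
    rewrite -ler_sqr ?nnegrE ?mulr_ge0 ?(ltW p0) ?(ltW eta0)//.
    by rewrite real_normK ?num_real.
  have op := trop w lam (ltW lam0) trl; rewrite HA// /lam a2 in op.
  have rho0 : 0 <= c2 * t^-1 by rewrite mulr_ge0// invr_ge0 ltW.
  have Mg' i j : `|M i j - g (c i) j| <= c2 * t^-1 by rewrite hM mxE; exact: Mg.
  have ti0 : 0 <= t^-1 by rewrite invr_ge0 ltW.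
  apply: (le_trans (usvt_error heta hn hp c10 c20 ti0 ph g1 M1 Mg' rho0 (lexx _) Cc op (hMhat w))).
  rewrite -/C2 -/rate /G.
  suff : 4 * ((observed_proportion mk O w - p) ^+ 2 / p ^+ 2) <= C3 / p ^+ 2 * dev w.
    by move: h1 h2 h3; lra.
  rewrite /dev mulrA mulrAC ler_wpM2r ?sqr_ge0// ler_wpM2r ?invr_ge0 ?(ltW pp0)//.
  by rewrite lerDr divr_ge0// sqr_ge0.
have MSEG := integral_le_mean P bG SE0 SEG.
apply: (le_trans MSEG); rewrite lee_fin.
have -> : mean P G = 4 / lam ^+ q.*2 * mean P tr + C3 / p ^+ 2 * mean P dev + C2 * rate.
  rewrite /G meanD ?mean_cst; [|by apply: bmD => //; exact: bmD|exact: bm_cst].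
  rewrite meanD//; last exact: bmD.
  rewrite meanD// !meanZ//; last exact: bm_indic.
  by rewrite mean_indic// PA mulr0 add0r.
have trle : 4 / lam ^+ q.*2 * mean P tr <= 4 * C1 * rate.
  have := HC1 a n q a0 hn a24 qa (ltW aq); rewrite -/lam => H.
  rewrite -[leRHS]mulrA -[leLHS]mulrA ler_wpM2l//.
  apply: (@le_trans _ _ (C1 / n%:R)); last by rewrite ler_wpM2l.
  apply: le_trans H; rewrite mulrC ler_wpM2r//.
  by rewrite invr_ge0 exprn_ge0// ltW.
(* The variance bound 2p / n^2 divided by p^2 is 2 / (n * np), and np >= 1. *)
have devle : C3 / p ^+ 2 * mean P dev <= C3 * 2 * rate.
  rewrite -mulrA -[leRHS]mulrA ler_wpM2l//.
  apply: (@le_trans _ _ (p ^- 2 * (2 * p / n%:R ^+ 2))).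
    by rewrite ler_wpM2l// invr_ge0 ltW.
  have -> : p ^- 2 * (2 * p / n%:R ^+ 2) = 2 * (n%:R^-1 * (n%:R * p)^-1).
    by field; rewrite !gt_eqF.
  rewrite ler_wpM2l//; apply: le_trans n_rate.
  by rewrite ler_piMr ?invr_ge0 ?(ltW nR)// invf_le1// (lt_le_trans _ np1).
have rest : 0 <= C4 * rate by rewrite mulr_ge0 ?(ltW rate0)// addr_ge0.
rewrite [leRHS]mulrDl [X in _ <= X + _]mulrDl [X in _ <= X + _ + _]mulrDl.
rewrite -[leLHS]addr0; apply: lerD => //.
by apply: lerD => //; exact: lerD.
Qed.
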